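(* Let $\mathbb{K}$ be a field in which $2$ is invertible, and for each partition diagram $\pi$ let $\eta_\pi:=\sum_{\sigma\ge\pi}2^{l(\sigma)}M_\sigma\in\mathrm{ParQSym}$. Let $\rho=\rho_1\otimes\cdots\otimes\rho_n$ and $\sigma=\sigma_1\otimes\cdots\otimes\sigma_m$ be non-empty partition diagrams with all $\rho_i,\sigma_j$ non-empty $\otimes$-irreducible. Then $$\eta_\rho\star\eta_\sigma=\sum(-1)^{n(\pi')}\eta_{\pi'},$$ where the sum is over all expressions $\pi'=\pi_1\divideontimes_1\pi_2\divideontimes_2\cdots\divideontimes_{n+m-1}\pi_{n+m}$ such that $\pi_1\pi_2\cdots\pi_{n+m}$ is a word shuffle of $\rho_1\cdots\rho_n$ and $\sigma_1\cdots\sigma_m$, each $\divideontimes_l\in\{\otimes,\bullet\}$, and $\divideontimes_l$ may be $\bullet$ only when ($\pi_l=\rho_i$ and $\pi_{l+1}=\sigma_j$) or ($\pi_l=\sigma_j$ and $\pi_{l+1}=\rho_i$) for some $1\le i\le n$, $1\le j\le m$; and where $$n(\pi')=\#\{l:\ \divideontimes_l=\bullet,\ \pi_l=\sigma_j,\ \pi_{l+1}=\rho_i\text{ for some }1\le i\le n,\ 1\le j\le m\}.$$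
   Context: **Shuffles.** In the sum the letters $\rho_1,\dots,\rho_n,\sigma_1,\dots,\sigma_m$ are treated as $n+m$ distinct letters (even if some coincide as diagrams), so there are $\binom{n+m}{n}$ word shuffles, and different pairs (shuffle, choice of $\divideontimes_1,\dots,\divideontimes_{n+m-1}$) are different expressions. **Partition diagrams.** A partition diagram of order $k\ge 0$ is a set partition of $\{1,\dots,k,1',\dots,k'\}$; for $k=0$ the only one is the empty diagram $\emptyset$. For $\pi$ of order $k$ and $\rho$ of order $m$, $\pi\otimes\rho$ is the diagram of order $k+m$ whose blocks are the blocks of $\pi$ and the blocks of $\rho$ with labels shifted by $k$ ($i\mapsto i+k$, $i'\mapsto (i+k)'$). If $k,m\ge1$, $\pi\bullet\rho$ is obtained from $\pi\otimes\rho$ by merging the block containing $k'$ with the block containing $(k+1)'$. The empty diagram is the unit for both operations. A diagram is $\otimes$-irreducible (resp. $\bullet$-irreducible) if it is not $\rho\otimes\sigma$ (resp. $\rho\bullet\sigma$) with $\rho,\sigma$ both non-empty. Every non-empty $\pi$ is uniquely $\pi_1\otimes\cdots\otimes\pi_l$ with all $\pi_i$ non-empty and $\otimes$-irreducible; $l(\pi):=l$, and $l(\emptyset):=0$. **Refinement.** Every non-empty $\pi$ can be uniquely written $\pi=\pi_1\divideontimes_1\pi_2\divideontimes_2\cdots\divideontimes_{n-1}\pi_n$ with each $\divideontimes_i\in\{\otimes,\bullet\}$ and each $\pi_i$ non-empty and both $\otimes$- and $\bullet$-irreducible (on non-empty diagrams $\otimes$ and $\bullet$ associate with each other, so no brackets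 are needed). Put $S(\pi)=\{i\in\{1,\dots,n-1\}:\divideontimes_i=\otimes\}$. For non-empty $\pi,\sigma$ write $\pi\sim\sigma$ if their sequences $(\pi_1,\dots,\pi_n)$ and $(\sigma_1,\dots,\sigma_m)$ are equal; $\pi\le\sigma$ if $\pi\sim\sigma$ and $S(\sigma)\subseteq S(\pi)$. The empty diagram is related only to itself, with $\emptyset\le\emptyset$. **Algebra ParQSym.** $\mathrm{ParQSym}$ is the $\mathbb{K}$-vector space with basis $\{M_\pi\}$ indexed by all partition diagrams, with product $\star$: $M_\emptyset$ is the unit, and for non-empty $\rho=\rho_1\otimes\cdots\otimes\rho_n$, $\sigma=\sigma_1\otimes\cdots\otimes\sigma_m$ with all $\rho_i,\sigma_j$ non-empty $\otimes$-irreducible, $$M_\rho\star M_\sigma=\sum M_{(\rho'_1\bullet\sigma'_1)\otimes\cdots\otimes(\rho'_k\bullet\sigma'_k)},$$ over all $k\in\mathbb{N}$ and all pairs of sequences of diagrams $(\rho'_1,\dots,\rho'_k)$, $(\sigma'_1,\dots,\sigma'_k)$ that become $(\rho_1,\dots,\rho_n)$, respectively $(\sigma_1,\dots,\sigma_m)$, after deleting all empty diagrams, and such that $\rho'_s\bullet\sigma'_s\ne\emptyset$ for all $1\le s\le k$. *)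

(* Defs.v *)
From HB Require Import structures.
From mathcomp Require Import all_boot all_algebra.

Set Implicit Arguments.
Unset Strict Implicit.
Unset Printing Implicit Defensive.

Import GRing.Theory.

(* [inl i] is the upper label i+1 and [inr i] is the lower label (i+1)'. *)
Definition vertex (k : nat) : finType := ('I_k + 'I_k)%type.

Definition vlshift k m (u : vertex k) : vertex (k + m) :=
  match u with inl i => inl (lshift m i) | inr i => inr (lshift m i) end.

Definition vrshift k m (u : vertex m) : vertex (k + m) :=
  match u with inl i => inl (rshift k i) | inr i => inr (rshift k i) end.

Lemma vertex_cover_tensor k m (v : vertex (k + m)) :
  (exists u, v = vlshift m u) \/ (exists u, v = vrshift k u).
Proof.
by case: v => i; rewrite -(splitK i); case: (split i) => j /=;
  [left; exists (inl j) | right; exists (inl j)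
  |left; exists (inr j) | right; exists (inr j)].
Qed.

Definition tensor_blocks k m (P : {set {set vertex k}}) (Q : {set {set vertex m}})
    : {set {set vertex (k + m)}} :=
  [set @vlshift k m @: (B : {set vertex k}) | B in P]
  :|: [set @vrshift k m @: (B : {set vertex m}) | B in Q].

Lemma vlshift_inj k m : injective (@vlshift k m).
Proof. by move=> [i|i] [j|j] //= [] /(@ord_inj k) ->. Qed.

Lemma vrshift_inj k m : injective (@vrshift k m).
Proof. by move=> [i|i] [j|j] //= [] /addnI /(@ord_inj m) ->. Qed.

Lemma vlrshift k m (u : vertex k) (v : vertex m) : vlshift m u != vrshift k v.
Proof.
by apply/eqP; case: u => i; case: v => j //= [] e;
  have := ltn_ord i; rewrite e ltnNge leq_addr.
Qed.

Lemma tensor_blocksP k m P Q :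
  partition P [set: vertex k] -> partition Q [set: vertex m] ->
  partition (tensor_blocks P Q) [set: vertex (k + m)].
Proof.
move=> /and3P[/eqP cP /trivIsetP tP nP] /and3P[/eqP cQ /trivIsetP tQ nQ].
apply/and3P; split.
- rewrite eqEsubset subsetT /=; apply/subsetP => v _.
  case: (vertex_cover_tensor v) => -[u ->].
  + have /bigcupP[B BP uB] : u \in cover P by rewrite cP inE.
    apply/bigcupP; exists (@vlshift k m @: B); last exact: (imset_f (@vlshift k m)).
    by rewrite inE (imset_f (fun B : {set _} => _ @: B)).
  + have /bigcupP[B BP uB] : u \in cover Q by rewrite cQ inE.
    apply/bigcupP; exists (@vrshift k m @: B); last exact: (imset_f (@vrshift k m)).
    by rewrite inE (imset_f (fun B : {set vertex m} => _ @: B)) ?orbT.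
- have LR (A : {set vertex k}) (B : {set vertex m}) :
    [disjoint @vlshift k m @: A & @vrshift k m @: B].
    apply/pred0P => v /=; apply/negP => /andP[/imsetP[u _ ->] /imsetP[w _ /eqP]].
    by rewrite (negPf (vlrshift u w)).
  apply/trivIsetP => X Y; rewrite !inE.
  move=> /orP[/imsetP[A AP ->]|/imsetP[A AQ ->]] /orP[/imsetP[B BP ->]|/imsetP[B BQ ->]] //.
  + move=> nAB; rewrite imset_disjoint; [|exact: vlshift_inj].
    by apply: tP => //; apply: contra_neq nAB => ->.
  + by rewrite disjoint_sym.
  + move=> nAB; rewrite imset_disjoint; [|exact: vrshift_inj].
    by apply: tQ => //; apply: contra_neq nAB => ->.
- rewrite inE negb_or; apply/andP; split; apply/imsetP => -[B BP e].
  + by move/eqP: e; rewrite eq_sym imset_eq0 => /eqP e; rewrite -e BP in nP.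
  + by move/eqP: e; rewrite eq_sym imset_eq0 => /eqP e; rewrite -e BP in nQ.
Qed.

Definition merge_blocks (T : finType) (P : {set {set T}}) (x y : T) : {set {set T}} :=
  (pblock P x :|: pblock P y) |: (P :\: [set pblock P x; pblock P y]).

Lemma merge_blocksP (T : finType) (P : {set {set T}}) (x y : T) :
  partition P [set: T] -> partition (merge_blocks P x y) [set: T].
Proof.
move=> /and3P[/eqP cP tP nP].
have xc z : z \in cover P by rewrite cP inE.
have inP z : pblock P z \in P by rewrite pblock_mem.
have inz z : z \in pblock P z by rewrite mem_pblock.
have D z B : B \in P -> B != pblock P z -> [disjoint pblock P z & B].
  by move=> BP; rewrite eq_sym; apply: (trivIsetP tP).
apply/and3P; split.
- rewrite eqEsubset subsetT /=; apply/subsetP => z _.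
  have [e|n] := boolP (pblock P z \in [set pblock P x; pblock P y]).
  + apply/bigcupP; exists (pblock P x :|: pblock P y); first by rewrite !inE eqxx.
    by move: e; rewrite !inE => /orP[] /eqP <-; rewrite inz ?orbT.
  + by apply/bigcupP; exists (pblock P z) => //; rewrite in_setU1 in_setD n inP orbT.
- have M B : B \in P :\: [set pblock P x; pblock P y] ->
    [disjoint pblock P x :|: pblock P y & B].
    rewrite !inE negb_or => /andP[/andP[nx ny] BP].
    by rewrite -setI_eq0 setIUl setU_eq0 !setI_eq0 !D.
  apply/trivIsetP => A B; rewrite !in_setU1.
  move=> /orP[/eqP ->|AP] /orP[/eqP ->|BP]; rewrite ?eqxx //.
  + by move=> _; apply: M.
  + by move=> _; rewrite disjoint_sym; apply: M.
  + by apply: (trivIsetP tP); [move: AP|move: BP]; rewrite in_setD => /andP[].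
- rewrite !inE negb_or (negPf nP) andbF andbT eq_sym.
  by apply/eqP => /setP /(_ x); rewrite !inE inz.
Qed.

Definition diagram_of_order (k : nat) : finType :=
  {P : {set {set vertex k}} | partition P [set: vertex k]}.

Definition of_partition k (P : {set {set vertex k}})
    (h : partition P [set: vertex k]) : diagram_of_order k := exist _ P h.

Definition diagram : choiceType := {k : nat & diagram_of_order k}.

Lemma empty_blocksP : partition set0 [set: vertex 0].
Proof.
apply/and3P; split; last by rewrite inE.
- by rewrite /cover big_set0; apply/eqP/setP => -[] [].
- by apply/trivIsetP => A B; rewrite inE.
Qed.

Definition empty_diagram : diagram :=
  Tagged diagram_of_order (of_partition empty_blocksP).

Definition tensor_of_order k m (P : diagram_of_order k) (Q : diagram_of_order m)
    : diagram_of_order (k + m) :=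
  of_partition (tensor_blocksP (valP P) (valP Q)).

Definition bullet_of_order k m
    (P : diagram_of_order k.+1) (Q : diagram_of_order m.+1)
    : diagram_of_order (k.+1 + m.+1) :=
  of_partition (merge_blocksP
    (inr (lshift m.+1 (@ord_max k))) (inr (rshift k.+1 (@ord0 m)))
    (tensor_blocksP (valP P) (valP Q))).

Definition tensor (p q : diagram) : diagram :=
  Tagged diagram_of_order (tensor_of_order (tagged p) (tagged q)).

Definition bullet (p q : diagram) : diagram :=
  match p, q with
  | existT 0 _, _ => q
  | existT _.+1 _, existT 0 _ => p
  | existT k.+1 P, existT m.+1 Q =>
      Tagged diagram_of_order (bullet_of_order P Q)
  end.

Definition tensor_irreducible (p : diagram) : Prop :=
  ~ exists r s : diagram,
      [/\ r <> empty_diagram, s <> empty_diagram & p = tensor r s].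

Definition bullet_irreducible (p : diagram) : Prop :=
  ~ exists r s : diagram,
      [/\ r <> empty_diagram, s <> empty_diagram & p = bullet r s].

Definition tensors (s : seq diagram) : diagram := foldr tensor empty_diagram s.

Inductive connective := Tensor | Bullet.

Definition is_bullet (c : connective) : bool := if c is Bullet then true else false.

Lemma is_bulletK :
  cancel is_bullet (fun b : bool => if b then Bullet else Tensor).
Proof. by case. Qed.

HB.instance Definition _ := Equality.copy connective (can_type is_bulletK).
HB.instance Definition _ := Choice.copy connective (can_type is_bulletK).
HB.instance Definition _ := Countable.copy connective (can_type is_bulletK).
HB.instance Definition _ : isFinite connective := CanIsFinite is_bulletK.

Definition apply_connective (c : connective) : diagram -> diagram -> diagram :=
  match c with Tensor => tensor | Bullet => bullet end.

(* [expression_value [:: p1; ...; pn] [:: c1; ...; c_(n-1)]] is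
   p1 c1 p2 c2 ... c_(n-1) pn, bracketed to the left. *)
Definition expression_value (ps : seq diagram) (cs : seq connective) : diagram :=
  if ps is p :: ps'
  then foldl (fun x cy => apply_connective cy.1 x cy.2) p (zip cs ps')
  else empty_diagram.

(* Imported only here: classical_sets shadows the notations for finite sets. *)
From mathcomp Require Import finmap boolp classical_sets fsbigop.
From mathcomp Require Import monalg.

Local Open Scope classical_set_scope.
Local Open Scope ring_scope.

Definition tensor_factorization (p : diagram) (s : seq diagram) : Prop :=
  (forall q, q \in s -> q <> empty_diagram /\ tensor_irreducible q)
  /\ p = tensors s.

(* Every diagram has exactly one such factorization (the empty one for the empty
   diagram), so the default value of [xget] is never used. *)
Definition tensor_factors (p : diagram) : seq diagram :=
  xget [::] [set s | tensor_factorization p s].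

Definition tensor_length (p : diagram) : nat := size (tensor_factors p).

Definition full_factorization
    (p : diagram) (ps : seq diagram) (cs : seq connective) : Prop :=
  [/\ forall q, q \in ps ->
        [/\ q <> empty_diagram, tensor_irreducible q & bullet_irreducible q],
      (0 < size ps)%N, size cs = (size ps).-1 & p = expression_value ps cs].

(* The set S(p) when [cs] are the connectives of p, with positions from 0. *)
Definition tensor_positions (cs : seq connective) : set nat :=
  [set i | (i < size cs)%N /\ nth Tensor cs i = Tensor].

(* As the full factorization of a non-empty diagram is unique, the common [ps]
   says that p ~ q, and [cp], [cq] are the connectives of p and q. *)
Definition diagram_le (p q : diagram) : Prop :=
  (p = empty_diagram /\ q = empty_diagram) \/
  [/\ p <> empty_diagram, q <> empty_diagram &
      exists ps cp cq,
        [/\ full_factorization p ps cp, full_factorization q ps cq &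
            tensor_positions cq `<=` tensor_positions cp]].

Definition ParQSym (K : fieldType) := {malg K[diagram]}.

Definition basisM (K : fieldType) (p : diagram) : ParQSym K := << p >>.

(* The list w of pairs encodes the two sequences of equal length k = size w. *)
Definition quasi_shuffles (r s : seq diagram) : set (seq (diagram * diagram)) :=
  [set w | [/\ [seq p <- unzip1 w | p != empty_diagram] = r,
               [seq p <- unzip2 w | p != empty_diagram] = s &
               all (fun pq => bullet pq.1 pq.2 != empty_diagram) w]].

Definition star_basis (K : fieldType) (p q : diagram) : ParQSym K :=
  if p == empty_diagram then basisM K q
  else if q == empty_diagram then basisM K p
  else \sum_(w \in quasi_shuffles (tensor_factors p) (tensor_factors q))
         basisM K (tensors [seq bullet pq.1 pq.2 | pq <- w]).

Definition star (K : fieldType) (x y : ParQSym K) : ParQSym K :=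
  \sum_(p <- msupp x) \sum_(q <- msupp y) (x@_p * y@_q) *: star_basis K p q.

Definition eta (K : fieldType) (p : diagram) : ParQSym K :=
  \sum_(q \in [set q | diagram_le p q]) (2 ^+ tensor_length q : K) *: basisM K q.

(* The n + m distinct letters: [inl i] stands for rho_(i+1) and [inr j] for
   sigma_(j+1). *)
Definition letter (n m : nat) : finType := ('I_n + 'I_m)%type.

Definition is_rho n m (a : letter n m) : bool := if a is inl _ then true else false.

Definition letter_diagram n m (r : n.-tuple diagram) (s : m.-tuple diagram)
    (a : letter n m) : diagram :=
  match a with inl i => tnth r i | inr j => tnth s j end.

Definition word_shuffle n m (w : seq (letter n m)) : bool :=
  ([seq a <- w | is_rho a] == [seq inl i | i <- enum 'I_n])
  && ([seq a <- w | ~~ is_rho a] == [seq inr j | j <- enum 'I_m]).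

Definition expression (n m : nat) : finType :=
  ((n + m).-tuple (letter n m) * (n + m).-1.-tuple connective)%type.

Definition rho_at n m (e : expression n m) (l : nat) : bool :=
  nth false (map (@is_rho n m) e.1) l.

Definition admissible n m (e : expression n m) : bool :=
  word_shuffle e.1
  && [forall l : 'I_(n + m).-1,
        (tnth e.2 l == Bullet) ==> (rho_at e l != rho_at e l.+1)].

Definition sign_exponent n m (e : expression n m) : nat :=
  #|[pred l : 'I_(n + m).-1 |
      [&& tnth e.2 l == Bullet, ~~ rho_at e l & rho_at e l.+1]]|.

Definition value n m (r : n.-tuple diagram) (s : m.-tuple diagram)
    (e : expression n m) : diagram :=
  expression_value (map (letter_diagram r s) e.1) e.2.

(* Main.v *)
Require Import Defs.
From mathcomp Require Import all_boot all_algebra.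

Set Implicit Arguments.
Unset Strict Implicit.
Unset Printing Implicit Defensive.

(* Both sides are sums of basis elements whose tensor blocks are read off the two
   words rho_1 ... rho_n and sigma_1 ... sigma_m: each block is a bullet product of
   consecutive rho_i, then of consecutive sigma_j, where one of the two runs may be
   empty.  In the product, a block contributes 2 for each non-empty run.  In the
   signed sum, a term is a shuffle with connectives; a block contributes 2, times for
   each of its bullets 1 from coarsening a tensor plus the sign of an original bullet:
   1 + 0 within one word, 1 + 1 from rho to sigma, 1 - 1 from sigma to rho.  So the
   blocks with a sigma before a rho cancel and mixed blocks count 2 * 2.

   Everything rests on unique factorization of diagrams.  It follows from a Levi
   lemma: if p c q = s c' t with p shorter than s, then s = p c u and q = u c' t. *)

(** * Diagrams as relations on labels *)

(* The label i + 1, or (i + 1)' when the boolean is true, in any order k > i: unlike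
   [vertex k], this type does not depend on the order. *)
Definition node : Type := (bool * nat)%type.

Definition node_of k (u : vertex k) : node :=
  match u with inl i => (false, nat_of_ord i) | inr i => (true, nat_of_ord i) end.

Lemma node_of_inj k : injective (@node_of k).
Proof. by move=> [i|i] [j|j] // [] /ord_inj ->. Qed.

Lemma node_of_lt k (u : vertex k) : (node_of u).2 < k.
Proof. by case: u => i /=. Qed.

Lemma node_of_surj k (x : node) : x.2 < k -> exists u : vertex k, node_of u = x.
Proof.
by case: x => -[] i /= h; [exists (inr (Ordinal h)) | exists (inl (Ordinal h))].
Qed.

Lemma node_of_vlshift k m (u : vertex k) : node_of (vlshift m u) = node_of u.
Proof. by case: u. Qed.

Definition node_add k (x : node) : node := (x.1, k + x.2).
Definition node_sub k (x : node) : node := (x.1, x.2 - k).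

Lemma node_of_vrshift k m (u : vertex m) : node_of (vrshift k u) = node_add k (node_of u).
Proof. by case: u. Qed.

Lemma node_addK k : cancel (node_add k) (node_sub k).
Proof. by case=> b i; rewrite /node_sub /= addKn. Qed.

Definition order (p : diagram) : nat := tag p.
Definition blocks (p : diagram) : {set {set vertex (order p)}} := val (tagged p).

Lemma blocks_partition p : partition (blocks p) [set: vertex (order p)].
Proof. exact: (valP (tagged p)). Qed.

(* [false] when a node is not a vertex of p. *)
Definition conn (p : diagram) (x y : node) : bool :=
  [exists u, [exists v,
    [&& node_of u == x, node_of v == y & v \in pblock (blocks p) u]]].

Lemma conn_node p u v : conn p (node_of u) (node_of v) = (v \in pblock (blocks p) u).
Proof.
apply/existsP/idP => [[u' /existsP[v' /and3P[/eqP/node_of_inj-> /eqP/node_of_inj->]]] //|h].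
by exists u; apply/existsP; exists v; rewrite !eqxx.
Qed.

Lemma conn_lt p x y : conn p x y -> (x.2 < order p) && (y.2 < order p).
Proof.
case/existsP => u /existsP[v /and3P[/eqP <- /eqP <- _]].
by rewrite !node_of_lt.
Qed.

Lemma conn_ltl p x y : conn p x y -> x.2 < order p.
Proof. by case/conn_lt/andP. Qed.

Lemma conn_gel p (x y : node) : order p <= x.2 -> conn p x y = false.
Proof. by apply: contraTF => /conn_ltl; rewrite ltnNge. Qed.

Lemma partition_pblock_eq (T : finType) (P : {set {set T}}) :
  partition P [set: T] -> P = [set pblock P x | x in T].
Proof.
case/and3P => /eqP cP tP nP; apply/setP => B; apply/idP/imsetP => [BP|[x _ ->]].
  have /set0Pn[x xB] : B != set0 by apply: contraNneq nP => <-.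
  by exists x => //; rewrite (def_pblock tP BP xB).
by rewrite pblock_mem // cP inE.
Qed.

Lemma mem_pblock_sym (T : finType) (P : {set {set T}}) x y :
  partition P [set: T] -> (x \in pblock P y) = (y \in pblock P x).
Proof.
case/and3P => /eqP cP tP nP.
by rewrite -!eq_pblock ?cP ?inE // eq_sym.
Qed.

Lemma mem_pblock_eq (T : finType) (P : {set {set T}}) x y :
  partition P [set: T] -> (x \in pblock P y) = (pblock P x == pblock P y).
Proof.
by move=> h; rewrite mem_pblock_sym //; case/and3P: h => /eqP cP tP nP; rewrite eq_pblock ?cP ?inE.
Qed.

Lemma conn_sym p x y : conn p x y = conn p y x.
Proof.
by apply/existsP/existsP => -[u /existsP[v /and3P[eu ev h]]];
  exists v; apply/existsP; exists u; rewrite eu ev mem_pblock_sym ?blocks_partition.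
Qed.

Lemma conn_ger p (x y : node) : order p <= y.2 -> conn p x y = false.
Proof. by rewrite conn_sym; apply: conn_gel. Qed.

Lemma conn_refl p x : conn p x x = (x.2 < order p).
Proof.
apply/idP/idP => [/conn_ltl //|/node_of_surj[u <-]].
by rewrite conn_node mem_pblock_eq ?blocks_partition.
Qed.

Lemma conn_trans p y x z : conn p x y -> conn p y z -> conn p x z.
Proof.
move=> h1 h2; have [/andP[hx hy] /andP[_ hz]] := (conn_lt h1, conn_lt h2).
move: hx hy hz h1 h2 => /node_of_surj[u <-] /node_of_surj[v <-] /node_of_surj[w <-].
rewrite !conn_node !(mem_pblock_eq _ _ (blocks_partition p)).
by move=> /eqP <- /eqP <-.
Qed.

(** A partition is the set of the blocks of its points, so [conn] determines it. Equalities of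
    diagrams can then be proved without casts between orders such as k + (m + l) and k + m + l. *)
Lemma diagram_ext p q : order p = order q -> conn p =2 conn q -> p = q.
Proof.
case: p q => k P [m Q] /= e; subst m => h.
congr existT; apply: val_inj; rewrite /=.
rewrite (partition_pblock_eq (valP P)) (partition_pblock_eq (valP Q)).
apply: eq_imset => u; apply/setP => v.
by have := h (node_of u) (node_of v); rewrite !conn_node.
Qed.

Lemma order0 p : order p = 0 -> p = empty_diagram.
Proof.
by move=> h; apply: diagram_ext => // x y; rewrite !conn_gel ?h.
Qed.

Lemma order_gt0 p : p <> empty_diagram <-> 0 < order p.
Proof.
split=> [h|h e]; last by rewrite e in h.
by rewrite lt0n; apply/eqP => /order0.
Qed.

(** The two labels that a bullet merges, counted from 0: the last lower label of the first factor
    and the first lower label of the second. *)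
Definition node_end k : node := (true, k.-1).
Definition node_start : node := (true, 0).

Lemma order_tensor p q : order (tensor p q) = order p + order q.
Proof. by []. Qed.

(* Also correct when one of the diagrams is empty, since P or Q is then [false]. *)
Definition join_rel (c : bool) (k : nat) (P Q : rel node) : rel node := fun x y =>
  if x.2 < k then
    if y.2 < k then P x y
    else [&& c, P x (node_end k) & Q node_start (node_sub k y)]
  else if y.2 < k then [&& c, P y (node_end k) & Q node_start (node_sub k x)]
  else Q (node_sub k x) (node_sub k y).

Lemma pblock_vlshift k m (P : {set {set vertex k}}) (Q : {set {set vertex m}}) u :
  partition P [set: vertex k] -> partition Q [set: vertex m] ->
  pblock (tensor_blocks P Q) (vlshift m u) = @vlshift k m @: pblock P u.
Proof.
move=> hP hQ; case/and3P: (tensor_blocksP hP hQ) => _ tT _.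
case/and3P: (hP) => /eqP cP tP nP.
apply: (def_pblock tT); last by apply: imset_f; rewrite mem_pblock cP inE.
by rewrite inE (imset_f (fun B : {set _} => _ @: B)) // pblock_mem // cP inE.
Qed.

Lemma pblock_vrshift k m (P : {set {set vertex k}}) (Q : {set {set vertex m}}) u :
  partition P [set: vertex k] -> partition Q [set: vertex m] ->
  pblock (tensor_blocks P Q) (vrshift k u) = @vrshift k m @: pblock Q u.
Proof.
move=> hP hQ; case/and3P: (tensor_blocksP hP hQ) => _ tT _.
case/and3P: (hQ) => /eqP cP tP nP.
apply: (def_pblock tT); last by apply: imset_f; rewrite mem_pblock cP inE.
by rewrite inE (imset_f (fun B : {set vertex m} => _ @: B)) ?orbT // pblock_mem // cP inE.
Qed.

Lemma conn_tensor p q : conn (tensor p q) =2 join_rel false (order p) (conn p) (conn q).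
Proof.
move=> x y; rewrite /join_rel.
have [hx|hx] := boolP (x.2 < order p + order q); last first.
  rewrite -leqNgt in hx; rewrite conn_gel //.
  rewrite ltnNge (leq_trans (leq_addr _ _) hx) /=; case: ifP => // _.
  by rewrite conn_gel //= leq_subRL // (leq_trans (leq_addr _ _) hx).
have [hy|hy] := boolP (y.2 < order p + order q); last first.
  rewrite -leqNgt in hy; rewrite conn_ger //.
  have {}hy' := (leq_trans (leq_addr _ _) hy).
  rewrite (ltnNge y.2) hy' /=; case: ifP => // _.
  by rewrite conn_ger //= leq_subRL.
have [u eu] := node_of_surj hx; have [v ev] := node_of_surj hy.
rewrite -eu -ev (conn_node (p := tensor p q)) /blocks /=.
have LR (a : vertex (order p)) (b : vertex (order q)) :
    (vrshift (order p) b \in @vlshift (order p) (order q) @: pblock (blocks p) a) = false.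
  by apply/imsetP => -[z _ e]; have := vlrshift z b; rewrite e eqxx.
have RL (a : vertex (order p)) (b : vertex (order q)) :
    (vlshift (order q) a \in @vrshift (order p) (order q) @: pblock (blocks q) b) = false.
  by apply/imsetP => -[z _ e]; have := vlrshift a z; rewrite e eqxx.
case: (vertex_cover_tensor u) => -[a ->]; case: (vertex_cover_tensor v) => -[b ->];
  rewrite ?(pblock_vlshift _ (blocks_partition p) (blocks_partition q));
  rewrite ?(pblock_vrshift _ (blocks_partition p) (blocks_partition q));
  rewrite ?node_of_vlshift ?node_of_vrshift ?node_addK ?node_of_lt.
- by rewrite mem_imset ?conn_node //; apply: vlshift_inj.
- by rewrite LR /= ltnNge leq_addr.
- by rewrite RL /= ltnNge leq_addr.
- by rewrite /= !ltnNge !leq_addr /= mem_imset ?conn_node //; apply: vrshift_inj.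
Qed.

Lemma pblock_merge (T : finType) (P : {set {set T}}) x y z w :
  partition P [set: T] ->
  (w \in pblock (merge_blocks P x y) z) =
  (w \in pblock P z) || ((z \in pblock P x) || (z \in pblock P y)) &&
                        ((w \in pblock P x) || (w \in pblock P y)).
Proof.
move=> hP; have hM := merge_blocksP x y hP.
case/and3P: (hM) => _ tM _; case/and3P: (hP) => /eqP cP tP nP.
have inz a : a \in pblock P a by rewrite mem_pblock cP inE.
have [h|h] := boolP ((z \in pblock P x) || (z \in pblock P y)) => /=; last first.
  rewrite orbF (@def_pblock _ _ (pblock P z)) //.
  rewrite /merge_blocks in_setU1 in_setD in_set2 pblock_mem ?cP ?inE //.
  by rewrite !(mem_pblock_eq _ _ hP) in h; rewrite (negPf h) orbT.
rewrite (@def_pblock _ _ (pblock P x :|: pblock P y)) //; last by rewrite inE.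
  rewrite inE; case: (boolP (w \in pblock P z)) => //= wz.
  by move: h wz; rewrite !(mem_pblock_eq _ _ hP) => + /eqP ->.
by rewrite /merge_blocks in_setU1 eqxx.
Qed.

Lemma order_bullet p q : order (bullet p q) = order p + order q.
Proof. by case: p q => -[|k] P [[|m] Q]; rewrite /order /= ?addn0 ?add0n. Qed.

Lemma conn_bullet p q : conn (bullet p q) =2 join_rel true (order p) (conn p) (conn q).
Proof.
move=> x y.
have [p0|p0] := posnP (order p).
  rewrite (order0 p0) /join_rel /=.
  by case: x y => bx x [by_ y]; rewrite /node_sub /= !subn0; case: q => -[|m] Q.
have [q0|q0] := posnP (order q).
  have -> : bullet p q = p by rewrite (order0 q0); case: p p0 => -[|k] P.
  rewrite (order0 q0) /join_rel !(conn_gel (p := empty_diagram)) // !andbF.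
  case: ltnP => hx; last by rewrite conn_gel // if_same.
  by case: ltnP => hy //; rewrite conn_ger.
have [hx|hx] := boolP (x.2 < order p + order q); last first.
  rewrite -leqNgt in hx; rewrite conn_gel ?order_bullet // /join_rel.
  have hx' := leq_trans (leq_addr _ _) hx.
  rewrite ltnNge hx' /= (conn_ger _ (y := node_sub _ x)) ?andbF ?if_same /=;
    last by rewrite leq_subRL.
  by case: ifP => // _; rewrite conn_gel //= leq_subRL.
have [hy|hy] := boolP (y.2 < order p + order q); last first.
  rewrite -leqNgt in hy; rewrite conn_ger ?order_bullet // /join_rel.
  have hy' := leq_trans (leq_addr _ _) hy.
  rewrite (ltnNge y.2) hy' /= !(conn_ger _ (y := node_sub _ y)) ?andbF ?if_same //=;
    by rewrite leq_subRL.
case: p p0 q q0 hx hy => -[//|k] P _ [[//|m] Q] _ hx hy.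
have [u eu] := node_of_surj hx; have [v ev] := node_of_surj hy.
rewrite -eu -ev.
set p := existT _ k.+1 P; set q := existT _ m.+1 Q.
rewrite (conn_node (p := bullet p q)) /blocks /= pblock_merge; last first.
  exact: blocks_partition (tensor p q).
rewrite -!(conn_node (p := tensor p q)) !conn_tensor /= !addn0.
rewrite /join_rel /= ltnSn ltnn /= /node_sub /= subnn.
rewrite !(conn_sym p (true, k)) !(conn_sym q (true, 0)).
(* Two labels on the same side that are both linked to its border label were linked before, so
   merging only matters for labels on opposite sides. *)
case: (ltnP _ k.+1) => h1; case: (ltnP _ k.+1) => h2; rewrite ?andbF ?orbF //=.
- by apply: orb_idr => /andP[a b]; apply: conn_trans a _; rewrite conn_sym.
- by rewrite andbC.
- by apply: orb_idr => /andP[a b]; apply: conn_trans a _; rewrite conn_sym.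
Qed.

(** * Associativity, cancellation and the Levi lemma for the two connectives *)

Definition join := apply_connective.

Lemma conn_join c p q :
  conn (join c p q) =2 join_rel (is_bullet c) (order p) (conn p) (conn q).
Proof. by case: c; [apply: conn_tensor | apply: conn_bullet]. Qed.

Lemma order_join c p q : order (join c p q) = order p + order q.
Proof. by case: c => //; apply: order_bullet. Qed.

Lemma node_sub_add k m x : node_sub (k + m) x = node_sub m (node_sub k x).
Proof. by rewrite /node_sub subnDA. Qed.

(** With a non-empty middle factor, each connective acts at its own border, under either bracketing.
    With [q] empty the sides would be [join c' p r] and [join c p r]. *)
Lemma join_assoc c c' p q r : 0 < order q ->
  join c' (join c p q) r = join c p (join c' q r).
Proof.
move=> q0; apply: diagram_ext; first by rewrite !order_join addnA.
move=> x y; rewrite !conn_join /join_rel !conn_join /join_rel.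
rewrite /node_end /node_start /= !order_join !node_sub_add /= q0.
have -> : ((order p + order q).-1 < order p) = false.
  by rewrite -(prednK q0) addnS /= ltnNge leq_addr.
have -> : node_sub (order p) (true, (order p + order q).-1) = (true, (order q).-1).
  by rewrite /node_sub /= -(prednK q0) addnS /= addKn.
have lt i : (i < order p + order q) = (i < order p) || (i - order p < order q).
  case: (ltnP i (order p)) => h /=; first by rewrite ltn_addr.
  by rewrite ltn_subLR.
rewrite !lt.
move: (conn p) (conn q) (conn r) (order p) (order q) (is_bullet c) (is_bullet c')
  => P Q R k m b b'.
case: (x.2 < k) => /=; case: (y.2 < k) => //=;
  case: (x.2 - k < m) => //=; case: (y.2 - k < m) => //=;
  by rewrite ?andbA //; case: b; case: b'; rewrite ?andbF ?andbT.
Qed.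

(** This builds the piece cut out of a diagram in the Levi lemma. Reflexivity is asked only below
    [k], since [conn] is reflexive only up to the order. *)
Lemma diagram_of_rel k (R : rel node) :
  (forall x, x.2 < k -> R x x) -> symmetric R -> transitive R ->
  exists p, order p = k /\ forall x y, conn p x y = [&& x.2 < k, y.2 < k & R x y].
Proof.
move=> Rr Rs Rt.
pose E := fun u v : vertex k => R (node_of u) (node_of v).
have eqE : {in [set: vertex k] & &, equivalence_rel E}.
  move=> u v w _ _ _; split; first exact/Rr/node_of_lt.
  move=> uv; apply/idP/idP => [uw|]; last exact: Rt uv.
  by apply: Rt uw; rewrite Rs.
pose p : diagram := Tagged diagram_of_order (of_partition (equivalence_partitionP eqE)).
exists p; split=> // x y.
have key (u v : vertex k) : conn p (node_of u) (node_of v) = E u v.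
  by rewrite (conn_node (p := p)) pblock_equivalence_partition ?inE.
apply/idP/and3P => [h|[]].
  have /andP[hx hy] := conn_lt h; rewrite hx hy.
  move: hx hy h => /node_of_surj[u <-] /node_of_surj[v <-].
  by rewrite key.
by move=> /node_of_surj[u <-] /node_of_surj[v <-]; rewrite key.
Qed.

Lemma conn_joinl c p q x y : x.2 < order p -> y.2 < order p ->
  conn (join c p q) x y = conn p x y.
Proof. by move=> hx hy; rewrite conn_join /join_rel hx hy. Qed.

Lemma conn_joinr c p q x y :
  conn (join c p q) (node_add (order p) x) (node_add (order p) y) = conn q x y.
Proof. by rewrite conn_join /join_rel !node_addK /= !ltnNge !leq_addr. Qed.

Lemma conn_join_border c p q : 0 < order p -> 0 < order q ->
  conn (join c p q) (node_end (order p)) (node_add (order p) node_start) = is_bullet c.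
Proof.
move=> p0 q0; rewrite conn_join /join_rel node_addK /= addn0 ltnn prednK // leqnn.
by rewrite !conn_refl /= prednK // leqnn q0 !andbT.
Qed.

(** The low labels recover the first factor, the shifted ones the second, and the link across the
    border recovers the connective when both factors are non-empty. *)
Lemma join_cancel c c' p q s t :
  join c p q = join c' s t -> order p = order s ->
  [/\ p = s, q = t & 0 < order p -> 0 < order q -> c = c'].
Proof.
move=> e es.
have eq : q = t.
  apply: diagram_ext => [|x y].
    by have /eqP := congr1 order e; rewrite !order_join es eqn_add2l => /eqP.
  by rewrite -(conn_joinr c p) e es conn_joinr.
have ep : p = s.
  apply: diagram_ext => // x y.
  have [hx|hx] := ltnP x.2 (order p); last by rewrite !conn_gel -?es.
  have [hy|hy] := ltnP y.2 (order p); last by rewrite !conn_ger -?es.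
  by rewrite -(conn_joinl c q) // e conn_joinl -?es.
subst s t; split=> // p0 q0; apply: (can_inj is_bulletK).
by rewrite -(conn_join_border c p0 q0) e conn_join_border.
Qed.

(** The witness [u] is the restriction of [q] to its first [order s - order p] labels, which is the
    part of [s] beyond [p]. Reassociating and cancelling [p] then decomposes [q]. *)
Lemma join_levi c c' p q s t :
  join c p q = join c' s t -> order p < order s ->
  exists u, [/\ 0 < order u, s = join c p u & q = join c' u t].
Proof.
move=> e lt.
have eo : order p + order q = order s + order t by rewrite -!(order_join c) e !order_join.
have le : order s - order p <= order q.
  by rewrite leq_subLR eo leq_addr.
have [u [ou cu]] : exists u, order u = order s - order p /\
    forall x y, conn u x y = [&& x.2 < order s - order p, y.2 < order s - order p & conn q x y].
  apply: diagram_of_rel => [x hx||y x z]; last exact: conn_trans.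
  - by rewrite conn_refl (leq_trans hx).
  - by move=> x y; apply: conn_sym.
have u0 : 0 < order u by rewrite ou subn_gt0.
have es : s = join c p u.
  apply: diagram_ext; first by rewrite order_join ou subnKC // ltnW.
  move=> x y.
  have [hx|hx] := ltnP x.2 (order s); last by rewrite !conn_gel // order_join ou subnKC // ltnW.
  have [hy|hy] := ltnP y.2 (order s); last by rewrite !conn_ger // order_join ou subnKC // ltnW.
  rewrite -(conn_joinl c' t) // -e !conn_join /join_rel !cu /= subn_gt0 lt.
  have sub z : z.2 < order s -> (z.2 < order p) = false -> z.2 - order p < order s - order p.
    by move=> h /negbT; rewrite -leqNgt => h'; rewrite ltn_sub2rE.
  by case: ifP => hx'; case: ifP => hy' //=; rewrite ?sub.
exists u; split=> //.
have q0 : 0 < order q by apply: leq_trans le; rewrite -ou.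
suff [] : [/\ p = p, q = join c' u t & 0 < order p -> 0 < order q -> c = c] by [].
have := e; rewrite es join_assoc // => /join_cancel.
by case=> // _ -> _; split.
Qed.

(* Imported only here: classical_sets shadows the notations for finite sets. *)
From mathcomp Require Import finmap boolp classical_sets fsbigop monalg.

Implicit Types (P : pred connective) (l : seq (connective * diagram)).

Lemma join0r c p : join c p empty_diagram = p.
Proof.
apply: diagram_ext => [|x y]; first by rewrite order_join addn0.
rewrite conn_join /join_rel !(conn_gel (p := empty_diagram)) // !andbF.
case: ltnP => hx; last by rewrite conn_gel // if_same.
by case: ltnP => hy //; rewrite conn_ger.
Qed.

(** Pairing each connective with the letter after it keeps the two lists in step;
    [expression_value (p :: ps) cs] is [evaluate p (zip cs ps)] by conversion. *)
Definition evaluate (x : diagram) l : diagram :=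
  foldl (fun y ca => join ca.1 y ca.2) x l.

Lemma evaluate_join c x y l : 0 < order y -> evaluate (join c x y) l = join c x (evaluate y l).
Proof.
elim: l y => [//|[c' z] l IH] y y0 /=.
by rewrite join_assoc // IH // order_join ltn_addr.
Qed.

Lemma evaluate_cat x l1 c y l2 : 0 < order y ->
  evaluate x (l1 ++ (c, y) :: l2) = join c (evaluate x l1) (evaluate y l2).
Proof. by move=> y0; rewrite /evaluate foldl_cat /=; apply: evaluate_join. Qed.

Lemma order_evaluate x l : order x <= order (evaluate x l).
Proof.
elim: l x => [//|[c y] l IH] x /=; apply: leq_trans (IH _).
by rewrite order_join leq_addr.
Qed.

(** * Unique factorization *)

(** [P] selects the connectives that must not split [p]: [pred1 Tensor] for tensor factorizations,
    [predT] for full ones. One uniqueness proof then serves both. *)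
Definition irreducible P (p : diagram) : Prop :=
  0 < order p /\
  forall c r s, P c -> 0 < order r -> 0 < order s -> p <> join c r s.

Definition letters P (w : seq diagram) : Prop :=
  forall p, p \in w -> irreducible P p.

Lemma letters_cons P x w : letters P (x :: w) <-> irreducible P x /\ letters P w.
Proof.
split=> [h|[hx hw] p]; last by rewrite inE => /predU1P[->|/hw].
by split=> [|p pw]; apply: h; rewrite inE ?eqxx ?pw ?orbT.
Qed.

Lemma irreducible_tensor p :
  irreducible (pred1 Tensor) p <-> p <> empty_diagram /\ tensor_irreducible p.
Proof.
split=> -[/order_gt0 p0 h]; split=> //.
  by move=> [r [s [/order_gt0 r0 /order_gt0 s0 e]]]; apply: (h Tensor r s).
move=> c r s /eqP -> /order_gt0 r0 /order_gt0 s0 e; apply: h.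
by exists r, s.
Qed.

Lemma irreducible_full p : irreducible predT p <->
  [/\ p <> empty_diagram, tensor_irreducible p & bullet_irreducible p].
Proof.
split=> [[p0 h]|[/order_gt0 p0 ht hb]].
  split; first exact/order_gt0.
  - by move=> [r [s [/order_gt0 r0 /order_gt0 s0 e]]]; apply: (h Tensor r s).
  - by move=> [r [s [/order_gt0 r0 /order_gt0 s0 e]]]; apply: (h Bullet r s).
split=> // -[] r s _ /order_gt0 r0 /order_gt0 s0 e.
- by apply: ht; exists r, s.
- by apply: hb; exists r, s.
Qed.

(** Compare the first letters. If their orders differ, the Levi lemma splits the longer one by a
    connective in [P], against irreducibility; if they agree, cancel and continue. *)
Lemma evaluate_inj P x l y l' :
  letters P (x :: unzip2 l) -> letters P (y :: unzip2 l') ->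
  all P (unzip1 l) -> all P (unzip1 l') ->
  evaluate x l = evaluate y l' -> x = y /\ l = l'.
Proof.
(* A letter is not the value of a longer word; this settles the cases where exactly one word has
   length one. *)
have absurd c x0 z l0 y0 q : irreducible P y0 -> P c -> 0 < order x0 ->
    0 < order z -> 0 < order q -> join c x0 (evaluate z l0) = y0 -> False.
  move=> [_ h] Pc x00 z0 q0 e; apply: (h c x0 (evaluate z l0) Pc x00) => //.
  exact: leq_trans (order_evaluate _ _).
elim: l x y l' => [|[c z] l IH] x y [|[c' z'] l'] /letters_cons[ix h]
   /letters_cons[iy h'] //=.
- move=> _ /andP[Pc' _] e; case: (absurd c' y z' l' x z') => //.
  + by case: iy.
  + by case/letters_cons: h' => -[].
  + by case/letters_cons: h' => -[].
  + by rewrite e evaluate_join //; case/letters_cons: h' => -[].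
- move=> /andP[Pc _] _ e; case: (absurd c x z l y z) => //.
  + by case: ix.
  + by case/letters_cons: h => -[].
  + by case/letters_cons: h => -[].
  + by rewrite -e evaluate_join //; case/letters_cons: h => -[].
move=> /andP[Pc Pl] /andP[Pc' Pl'].
have [z0 z0'] : 0 < order z /\ 0 < order z'.
  by case/letters_cons: h => -[? _] _; case/letters_cons: h' => -[].
have ez0 := leq_trans z0 (order_evaluate z l).
have ez0' := leq_trans z0' (order_evaluate z' l').
rewrite !evaluate_join // => e.
have [lt|lt|eo] := ltngtP (order x) (order y).
- have [u [u0 ey _]] := join_levi e lt.
  by case: iy => _ /(_ c x u Pc) []; case: ix.
- have [u [u0 ex _]] := join_levi (esym e) lt.
  by case: ix => _ /(_ c' y u Pc') []; case: iy.
have [exy ee ec] := join_cancel e eo.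
have [-> ->] := IH z z' l' h h' Pl Pl' ee.
by rewrite exy ec //; case: ix.
Qed.

(** Either no connective of [P] splits [p], which is then a letter, or both parts have smaller order
    and their words are concatenated. *)
Lemma evaluate_exists P p : 0 < order p ->
  exists x l, [/\ letters P (x :: unzip2 l), all P (unzip1 l) & p = evaluate x l].
Proof.
have [n] := ubnP (order p); elim: n p => [//|n IH] p /ltnSE le p0.
have [[c [r [s [Pc r0 s0 e]]]]|h] :=
    pselect (exists c r s, [/\ P c, 0 < order r, 0 < order s & p = join c r s]).
  have er : order p = order r + order s by rewrite e order_join.
  have [|x [l [lx Pl ex]]] := IH r _ r0.
    by apply: leq_trans le; rewrite er -[ltnLHS]addn0 ltn_add2l.
  have [|y [l' [ly Pl' ey]]] := IH s _ s0.
    by apply: leq_trans le; rewrite er -[ltnLHS]add0n ltn_add2r.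
  have y0 : 0 < order y by case/letters_cons: ly => -[].
  exists x, (l ++ (c, y) :: l'); split; last by rewrite evaluate_cat // -ex -ey.
    rewrite /unzip2 map_cat -cat_cons => q; rewrite mem_cat => /orP[/lx //|/ly //].
  by rewrite /unzip1 map_cat all_cat Pl /= Pc.
exists p, [::]; split=> // q; rewrite inE => /eqP ->; split=> // c r s Pc r0 s0 e.
by apply: h; exists c, r, s.
Qed.

Lemma tensorsE x u : letters (pred1 Tensor) (x :: u) ->
  tensors (x :: u) = evaluate x [seq (Tensor, a) | a <- u].
Proof.
elim: u x => [|a u IH] x; first by move=> _; apply: (join0r Tensor).
move=> /letters_cons[_ h]; have a0 : 0 < order a by case/letters_cons: h => -[].
by rewrite [RHS](evaluate_join Tensor) // -IH.
Qed.

Lemma tensors_inj (u v : seq diagram) :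
  letters (pred1 Tensor) u -> letters (pred1 Tensor) v -> tensors u = tensors v -> u = v.
Proof.
have T0 x w : letters (pred1 Tensor) (x :: w) -> tensors (x :: w) <> empty_diagram.
  by case/letters_cons => -[x0 _] _; apply/order_gt0; rewrite (order_tensor x) ltn_addr.
case: u v => [|x u] [|y v] // hu hv; first by move/esym/T0 => /(_ hv).
  by move/T0 => /(_ hu).
rewrite !tensorsE // => /(@evaluate_inj (pred1 Tensor)) [].
- by rewrite /unzip2 -map_comp map_id.
- by rewrite /unzip2 -map_comp map_id.
- by rewrite /unzip1 -map_comp all_map; apply/allP.
- by rewrite /unzip1 -map_comp all_map; apply/allP.
by move=> -> /(congr1 unzip2); rewrite /unzip2 -!map_comp !map_id => ->.
Qed.

Lemma tensor_factorsK (u : seq diagram) :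
  letters (pred1 Tensor) u -> tensor_factors (tensors u) = u.
Proof.
move=> hu; apply: xget_unique => [|v [hv e]].
  by split=> // q /hu /irreducible_tensor.
by apply: tensors_inj => // q /hv /irreducible_tensor.
Qed.

(** * The diagrams above a given one *)

(* The tensor factorizations of the diagrams above [evaluate x l]. *)
Fixpoint coarsenings (x : diagram) l : seq (seq diagram) :=
  if l is (c, a) :: l' then
    (if c is Tensor then [seq x :: w | w <- coarsenings a l'] else [::])
    ++ coarsenings (bullet x a) l'
  else [:: [:: x]].

Definition coarser l l' : bool :=
  all2 (fun ca cb => (ca.2 == cb.2) && (is_bullet ca.1 ==> is_bullet cb.1)) l l'.

Definition bullet_head x (w : seq diagram) : seq diagram :=
  if w is y :: w' then bullet x y :: w' else w.

Definition all_nonempty (w : seq diagram) : bool := all (fun a => 0 < order a) w.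

Lemma letters_nonempty P (w : seq diagram) : letters P w -> all_nonempty w.
Proof. by move=> h; apply/allP => p /h[]. Qed.

(** Only the first block of a coarsening involves the first letter, so a bullet in front can be
    applied afterwards; [a] non-empty gives associativity. *)
Lemma coarsenings_bullet x a l : 0 < order a ->
  coarsenings (bullet x a) l = [seq bullet_head x w | w <- coarsenings a l].
Proof.
elim: l a => [//|[c b] l IH] a a0 /=.
have := @join_assoc Bullet Bullet x a b a0; rewrite /join /= => ->.
rewrite IH ?(order_join Bullet) ?ltn_addr // map_cat; congr (_ ++ _).
by case: c => //; rewrite -!map_comp.
Qed.

Lemma mem_coarsenings x l q : all_nonempty (unzip2 l) ->
  q \in [seq tensors w | w <- coarsenings x l] <-> exists2 l', coarser l l' & q = evaluate x l'.
Proof.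
elim: l x q => [|[c a] l IH] x q /=.
  move=> _; rewrite inE [tensor x _](join0r Tensor); split=> [/eqP ->|[[|//] _ ->] //].
  by exists [::].
move=> /andP[a0 l0]; rewrite map_cat mem_cat; split=> [/orP[]|[[//|[c' b] l'] /=]].
- case: c => // /mapP[_ /mapP[w wl ->] ->].
  have [] // := (IH a (tensors w) l0).1 => [|l' h e]; first exact: map_f.
  exists ((Tensor, a) :: l'); first by rewrite /= eqxx.
  by rewrite /= (evaluate_join Tensor) // -e.
- move=> /(IH _ _ l0)[l' h ->]; exists ((Bullet, a) :: l') => //=.
  by rewrite eqxx implybT.
- move=> /andP[/andP[/eqP <- h] h'] ->; apply/orP.
  case: c' h => h.
  + left; rewrite (evaluate_join Tensor) //; case: c h => // _.
    have /mapP[w wl ->] := (IH a (evaluate a l') l0).2 (ex_intro2 _ _ l' h' erefl).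
    apply/mapP; exists (x :: w) => //; exact: map_f.
  + by right; apply/IH => //; exists l'.
Qed.

(** A tensor cut of the product would fall inside [p], inside [q], or at their border, where the
    connective is a bullet. *)
Lemma irreducible_bullet p q :
  irreducible (pred1 Tensor) p -> irreducible (pred1 Tensor) q ->
  irreducible (pred1 Tensor) (bullet p q).
Proof.
move=> [p0 hp] [q0 hq]; split; first by rewrite (order_join Bullet) ltn_addr.
move=> c s t /eqP -> s0 t0; rewrite -[bullet p q]/(join Bullet p q) => e.
have [lt|lt|eo] := ltngtP (order p) (order s).
- by have [u [u0 _ eq]] := join_levi e lt; case: (hq Tensor u t).
- by have [u [u0 ep _]] := join_levi (esym e) lt; case: (hp Tensor s u).
- by have [_ _ /(_ p0 q0)] := join_cancel e eo.
Qed.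

Lemma coarsenings_letters x l w :
  letters (pred1 Tensor) (x :: unzip2 l) -> w \in coarsenings x l ->
  letters (pred1 Tensor) w.
Proof.
elim: l x w => [|[c a] l IH] x w; first by move=> h; rewrite inE => /eqP ->.
move=> /letters_cons[hx /letters_cons[/= ha hl]]; rewrite mem_cat => /orP[].
  case: c => // /mapP[v hv ->]; apply/letters_cons; split=> //.
  by apply: IH hv; apply/letters_cons.
apply: IH; apply/letters_cons; split=> //.
exact: irreducible_bullet.
Qed.

Lemma order_head_coarsenings x l w : w \in coarsenings x l ->
  order x <= order (head empty_diagram w).
Proof.
elim: l x w => [|[c a] l IH] x w /=; first by rewrite inE => /eqP ->.
rewrite mem_cat => /orP[]; first by case: c => // /mapP[v _ ->].
by move=> /IH; apply: leq_trans; rewrite (order_join Bullet) leq_addr.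
Qed.

(** The first block tells the two branches apart: it is [x] if the tensor is kept, and has order at
    least [order x + order a] once [a] is merged. *)
Lemma coarsenings_uniq x l : all_nonempty (unzip2 l) -> uniq (coarsenings x l).
Proof.
elim: l x => [//|[c a] l IH] x /= /andP[a0 l0].
rewrite cat_uniq IH // andbT; apply/andP; split.
  by case: c => //; rewrite map_inj_uniq ?IH // => u v [].
apply/hasPn => w /order_head_coarsenings h; case: c => //.
apply: contraL h => /mapP[v _ ->] /=.
by rewrite (order_join Bullet) -ltnNge -[ltnLHS]addn0 ltn_add2l.
Qed.

Lemma full_factorizationE p ps cs : full_factorization p ps cs <->
  exists x l, [/\ letters predT (x :: unzip2 l), p = evaluate x l,
                  ps = x :: unzip2 l & cs = unzip1 l].
Proof.
split=> [[h ps0 sz ->]|[x [l [h -> -> ->]]]].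
  case: ps h ps0 sz => [//|x ps] h _ /= sz.
  exists x, (zip cs ps); rewrite unzip1_zip ?unzip2_zip ?sz //.
  by split=> // q /h /irreducible_full.
split=> [q /h /irreducible_full //|//||]; first by rewrite /= !size_map.
by rewrite /= zip_unzip.
Qed.

Lemma tensor_positionsP (cs ds : seq connective) : size cs = size ds ->
  (tensor_positions ds `<=` tensor_positions cs)%classic <->
  all2 (fun c d => is_bullet c ==> is_bullet d) cs ds.
Proof.
rewrite /tensor_positions.
elim: cs ds => [|c cs IH] [|d ds] //= => [_|[sz]]; first by split=> // _ i [].
rewrite -(rwP andP) -IH //; split=> [h|[h0 h] [|i]] /=.
- split; first by case: c h => // h; case: d h => // h; case: (h 0) => //.
  by move=> i hi; apply: (h i.+1).
- by case: c h0; case: d.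
- by move=> /h.
Qed.

Lemma coarserE l l' : coarser l l' =
  (unzip2 l == unzip2 l')
  && all2 (fun c d => is_bullet c ==> is_bullet d) (unzip1 l) (unzip1 l').
Proof.
elim: l l' => [|[c a] l IH] [|[d b] l'] //=.
by rewrite /coarser /= in IH *; rewrite IH eqseq_cons -!andbA; do !bool_congr.
Qed.

(** Unique factorization forces the letters and connectives quantified in [diagram_le] to be the
    given ones; inclusion of the tensor positions then says that bullets stay bullets. *)
Lemma diagram_le_evaluate x l q : letters predT (x :: unzip2 l) ->
  diagram_le (evaluate x l) q <-> exists2 l', coarser l l' & q = evaluate x l'.
Proof.
move=> h.
have ne y k : letters predT (y :: unzip2 k) -> evaluate y k <> empty_diagram.
  by case/letters_cons => -[y0 _] _; apply/order_gt0/(leq_trans y0)/order_evaluate.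
have T (k : seq (connective * diagram)) : all predT (unzip1 k) by apply: all_predT.
split=> [[[/ne]//|[_ _ [ps [cp [cq [hp hq sub]]]]]]|[l']].
  have [y [k [hk ek ep ec]]] := (full_factorizationE _ _ _).1 hp.
  have [y' [k' [hk' -> ep' ec']]] := (full_factorizationE _ _ _).1 hq.
  have [ey el] := evaluate_inj h hk (T _) (T _) ek; subst y k.
  move: ep'; rewrite ep => -[ey e2]; subst y'.
  exists k' => //; rewrite coarserE e2 eqxx /=.
  apply/tensor_positionsP; last by rewrite -ec -ec'.
  by rewrite !size_map -(size_map snd l) -(size_map snd k') -/(unzip2 _) -/(unzip2 k') e2.
rewrite coarserE => /andP[/eqP e2 e1] ->.
have h' : letters predT (x :: unzip2 l') by rewrite -e2.
right; split; [exact: ne|exact: ne|].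
exists (x :: unzip2 l), (unzip1 l), (unzip1 l'); split.
- by apply/full_factorizationE; exists x, l.
- by apply/full_factorizationE; exists x, l'; rewrite -e2.
apply/tensor_positionsP => //.
by rewrite !size_map -(size_map snd l) -(size_map snd l') -/(unzip2 _) -/(unzip2 l') e2.
Qed.

Lemma coarsenings_cat_bullet y b l : all (pred1 Bullet) (unzip1 b) ->
  coarsenings y (b ++ l) = coarsenings (evaluate y b) l.
Proof.
elim: b y => [//|[c a] b IH] y /= /andP[/eqP -> hb] /=.
exact: IH.
Qed.

(** A tensor anywhere in the full factorization of [x] would split [x] at that place. *)
Lemma tensor_irreducible_bullets x : irreducible (pred1 Tensor) x ->
  exists y b, [/\ letters predT (y :: unzip2 b), all (pred1 Bullet) (unzip1 b) & x = evaluate y b].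
Proof.
case=> x0 hx; have [y [b [hb _ e]]] := evaluate_exists predT x0.
exists y, b; split=> //; apply: contraT => /allPn[c /mapP[[c' z] cb /= ->]].
case: c' cb => // cb _; exfalso.
case/splitPr: cb hb e => b1 b2 hb e.
have ne := letters_nonempty hb.
have y0 : 0 < order y by case/andP: ne.
have z0 : 0 < order z.
  by case/andP: ne => _ /allP; apply; apply/mapP; exists (Tensor, z) => //;
    rewrite mem_cat inE eqxx orbT.
apply: (hx Tensor (evaluate y b1) (evaluate z b2)) => //.
- exact: leq_trans (order_evaluate _ _).
- exact: leq_trans (order_evaluate _ _).
- by rewrite e evaluate_cat.
Qed.

(** The order is defined by full factorizations, the theorem by tensor factorizations. Refining a
    tensor-irreducible letter inserts only bullets, which cannot be coarsened, so the coarsenings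
    stay the same. *)
Lemma refine_to_letters x l : letters (pred1 Tensor) (x :: unzip2 l) ->
  exists y k, [/\ letters predT (y :: unzip2 k), evaluate x l = evaluate y k &
                  coarsenings x l = coarsenings y k].
Proof.
elim: l x => [|[c a] l IH] x /letters_cons[hx hl];
  have [y [b [hb bb ex]]] := tensor_irreducible_bullets hx.
  by exists y, b; rewrite -[b]cats0 coarsenings_cat_bullet // cats0 ex.
have [z [k [hk ea ca]]] := IH a hl.
have z0 : 0 < order z by case/letters_cons: hk => -[].
have a0 : 0 < order a by case/letters_cons: hl => -[].
exists y, (b ++ (c, z) :: k); split.
- rewrite /unzip2 map_cat -cat_cons => q; rewrite mem_cat => /orP[/hb //|/hk //].
- by rewrite evaluate_cat // -ex -ea; apply: evaluate_join.
- by rewrite coarsenings_cat_bullet // -ex /= !coarsenings_bullet // ca.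
Qed.

Lemma diagram_leP x l q : letters (pred1 Tensor) (x :: unzip2 l) ->
  diagram_le (evaluate x l) q <-> q \in [seq tensors w | w <- coarsenings x l].
Proof.
move=> /refine_to_letters[y [k [h -> ->]]].
have /andP[_ k0] := letters_nonempty h.
by split=> [/diagram_le_evaluate|/mem_coarsenings] h';
  [apply/mem_coarsenings|apply/diagram_le_evaluate] => //; apply: h'.
Qed.

Import GRing.Theory.

Local Open Scope ring_scope.

Lemma eta_evaluate (K : fieldType) x l : letters (pred1 Tensor) (x :: unzip2 l) ->
  eta K (evaluate x l) =
  \sum_(w <- coarsenings x l) (2 ^+ size w : K) *: basisM K (tensors w).
Proof.
move=> h.
have hw w : w \in coarsenings x l -> letters (pred1 Tensor) w by apply: coarsenings_letters.
rewrite /eta.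
have -> : [set q | diagram_le (evaluate x l) q]%classic =
    [set` [seq tensors w | w <- coarsenings x l]]%classic.
  by apply/seteqP; split=> q /=; move/(diagram_leP q h).
(* The list must be duplicate-free: distinct coarsenings are distinct tensor factorizations, hence
   have distinct products. *)
rewrite -fsbig_seq; last first.
  rewrite map_inj_in_uniq; last by move=> u v /hw hu /hw hv; apply: tensors_inj.
  by apply: coarsenings_uniq; case/andP: (letters_nonempty h).
rewrite big_map big_seq [RHS]big_seq; apply: eq_bigr => w /hw hl.
by rewrite /tensor_length tensor_factorsK.
Qed.

Lemma bullet0r p : bullet p empty_diagram = p.
Proof. exact: (join0r Bullet). Qed.

Lemma bulletA : associative bullet.
Proof.
move=> p q r; have [/order0 ->|q0] := posnP (order q).
  by rewrite bullet0r.
by have := @join_assoc Bullet Bullet p q r q0; rewrite /join /= => ->.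
Qed.

(** * Product of two sums over coarsenings *)

(** [F] stands for the basis and is arbitrary, so that inductions can pass to [prefixed F x] once a
    block is complete. *)
Definition coarsening_sum (K : fieldType) (V : lmodType K) (F : seq diagram -> V) x
    (l : seq (connective * diagram)) : V :=
  \sum_(w <- coarsenings x l) 2 ^+ size w *: F w.

Definition tensor_word (u : seq diagram) : seq (connective * diagram) :=
  [seq (Tensor, a) | a <- u].

(** The empty word needs a value because no letters may remain after a first block. *)
Definition eta_sum (K : fieldType) (V : lmodType K) (F : seq diagram -> V) (u : seq diagram) : V :=
  if u is x :: u' then coarsening_sum F x (tensor_word u') else F [::].

Arguments eta_sum : simpl never.

(** The outer recursion consumes [u]; the inner one covers the steps that consume only [v]. *)
Fixpoint quasi_shuffle (u : seq diagram) : seq diagram -> seq (seq (diagram * diagram)) :=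
  if u is a :: u' then
    fix quasi_shuffle_u v :=
      if v is b :: v' then
        [seq (a, empty_diagram) :: w | w <- quasi_shuffle u' v]
        ++ [seq (empty_diagram, b) :: w | w <- quasi_shuffle_u v']
        ++ [seq (a, b) :: w | w <- quasi_shuffle u' v']
      else [:: [seq (c, empty_diagram) | c <- u]]
  else fun v => [:: [seq (empty_diagram, c) | c <- v]].

Definition bullet_pairs (w : seq (diagram * diagram)) : seq diagram :=
  [seq bullet pq.1 pq.2 | pq <- w].

Definition quasi_sum (K : fieldType) (V : lmodType K) (F : seq diagram -> V) u v : V :=
  \sum_(w <- quasi_shuffle u v) F (bullet_pairs w).

Definition product_sum (K : fieldType) (V : lmodType K) (F : seq diagram -> V) u v : V :=
  eta_sum (fun p => eta_sum (fun q => quasi_sum F p q) v) u.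

(* The pairs (x bulleted with a prefix of u, the rest of u). *)
Fixpoint first_blocks (x : diagram) (u : seq diagram) : seq (diagram * seq diagram) :=
  (x, u) :: if u is a :: u' then first_blocks (bullet x a) u' else [::].

Lemma first_blocks_bullet x y u :
  first_blocks (bullet x y) u = [seq (bullet x zp.1, zp.2) | zp <- first_blocks y u].
Proof. by elim: u y => [|a u IH] y //=; rewrite -bulletA IH. Qed.

Definition prefixed (V : Type) (F : seq diagram -> V) x w := F (x :: w).

Section Sums.
Variables (K : fieldType) (V : lmodType K).
Implicit Types (F G : seq diagram -> V) (x y : diagram) (u v : seq diagram).

Lemma coarsening_sum_cons F x c a l :
  coarsening_sum F x ((c, a) :: l) =
  (if c is Tensor then 2 *: coarsening_sum (prefixed F x) a l else 0)
  + coarsening_sum F (bullet x a) l.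
Proof.
rewrite /coarsening_sum /= big_cat /=; congr (_ + _).
case: c; last by rewrite big_nil.
rewrite big_map scaler_sumr; apply: eq_bigr => w _.
by rewrite scalerA -exprS.
Qed.

Lemma coarsening_sum_nil F x : coarsening_sum F x [::] = 2 *: F [:: x].
Proof. by rewrite /coarsening_sum big_seq1 expr1. Qed.

(** Coarsenings are grouped by their first block, which accounts for one factor 2 and leaves a
    coarsening of the remaining letters. *)
Lemma eta_sum_first_blocks F x u :
  eta_sum F (x :: u) = \sum_(zp <- first_blocks x u) 2 *: eta_sum (prefixed F zp.1) zp.2.
Proof.
rewrite /eta_sum; elim: u x => [|a u IH] x /=; first by rewrite big_seq1 coarsening_sum_nil.
by rewrite coarsening_sum_cons big_cons /=; congr (_ + _); apply: IH.
Qed.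

Lemma eq_eta_sum F G u : F =1 G -> eta_sum F u = eta_sum G u.
Proof.
move=> e; rewrite /eta_sum; case: u => [|x u]; first exact: e.
by apply: eq_bigr => w _; rewrite e.
Qed.

Lemma eta_sum_add F G u : eta_sum (fun w => F w + G w) u = eta_sum F u + eta_sum G u.
Proof.
rewrite /eta_sum; case: u => [//|x u].
by rewrite -big_split; apply: eq_bigr => w _; rewrite scalerDr.
Qed.

Lemma eta_sum_scale c F u : eta_sum (fun w => c *: F w) u = c *: eta_sum F u.
Proof.
rewrite /eta_sum; case: u => [//|x u].
by rewrite scaler_sumr; apply: eq_bigr => w _; rewrite !scalerA mulrC.
Qed.

Lemma eta_sum_sum (I : Type) (r : seq I) (F : I -> seq diagram -> V) u :
  eta_sum (fun w => \sum_(i <- r) F i w) u = \sum_(i <- r) eta_sum (F i) u.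
Proof.
rewrite /eta_sum; case: u => [//|x u].
by rewrite exchange_big; apply: eq_bigr => w _; rewrite scaler_sumr.
Qed.

Lemma quasi_sum_cons F a u b v :
  quasi_sum F (a :: u) (b :: v) =
  quasi_sum (prefixed F a) u (b :: v) + quasi_sum (prefixed F b) (a :: u) v
  + quasi_sum (prefixed F (bullet a b)) u v.
Proof.
rewrite /quasi_sum /= !big_cat !big_map /= addrA /prefixed.
by under eq_bigr do rewrite bullet0r.
Qed.

Lemma quasi_sum0l F v : quasi_sum F [::] v = F v.
Proof. by rewrite /quasi_sum big_seq1 /bullet_pairs -map_comp map_id. Qed.

Lemma quasi_sum0r F u : quasi_sum F u [::] = F u.
Proof.
have -> : quasi_sum F u [::] = F (bullet_pairs [seq (c, empty_diagram) | c <- u]).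
  by case: u => [|a u]; rewrite /quasi_sum big_seq1.
by rewrite /bullet_pairs -map_comp map_id_in // => a _ /=; rewrite bullet0r.
Qed.

(* [product_sum] splits according to the first block of the result: [right_sum F y u v]
   is the part of [product_sum F u (y :: v)] where it only involves y :: v, and
   [left_sum F x u v] the part of [product_sum F (x :: u) v] where it involves x. *)
Definition right_sum F y u v : V :=
  \sum_(zp <- first_blocks y v) 2 *: product_sum (prefixed F zp.1) u zp.2.

Definition left_sum F x u v : V :=
  \sum_(zp <- first_blocks x u)
    (2 *: product_sum (prefixed F zp.1) zp.2 v
     + if v is b :: v' then 2 *: right_sum F (bullet zp.1 b) zp.2 v' else 0).

Lemma product_sum0r F u : product_sum F u [::] = eta_sum F u.
Proof. by rewrite /product_sum; apply: eq_eta_sum => w; apply: quasi_sum0r. Qed.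

Lemma product_sum0l F v : product_sum F [::] v = eta_sum F v.
Proof. exact: eq_eta_sum (quasi_sum0l F). Qed.

Lemma product_sum_cons F x u y v :
  product_sum F (x :: u) (y :: v) = left_sum F x u (y :: v) + right_sum F y (x :: u) v.
Proof.
have T1 : \sum_(zp <- first_blocks x u) \sum_(zq <- first_blocks y v)
    4 *: eta_sum (fun p => eta_sum (quasi_sum (prefixed F zp.1) p \o cons zq.1) zq.2) zp.2
    = \sum_(zp <- first_blocks x u) 2 *: product_sum (prefixed F zp.1) zp.2 (y :: v).
  apply: eq_bigr => -[z p] _ /=; rewrite /product_sum.
  rewrite (eq_eta_sum _ (fun w => eta_sum_first_blocks _ _ _)) eta_sum_sum scaler_sumr.
  by apply: eq_bigr => zq _; rewrite eta_sum_scale scalerA -natrM.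
have T2 : \sum_(zp <- first_blocks x u) \sum_(zq <- first_blocks y v)
    4 *: eta_sum (fun p => eta_sum (quasi_sum (prefixed F zq.1) (zp.1 :: p)) zq.2) zp.2
    = right_sum F y (x :: u) v.
  rewrite exchange_big; apply: eq_bigr => -[z q] _.
  rewrite /product_sum eta_sum_first_blocks scaler_sumr.
  by apply: eq_bigr => zp _; rewrite scalerA -natrM.
have T3 : \sum_(zp <- first_blocks x u) \sum_(zq <- first_blocks y v)
    4 *: product_sum (prefixed F (bullet zp.1 zq.1)) zp.2 zq.2
    = \sum_(zp <- first_blocks x u) 2 *: right_sum F (bullet zp.1 y) zp.2 v.
  apply: eq_bigr => -[z p] _ /=; rewrite /right_sum first_blocks_bullet big_map.
  by rewrite scaler_sumr; apply: eq_bigr => zq _; rewrite scalerA -natrM.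
rewrite /left_sum big_split /= -T1 -T2 -T3 addrAC -!big_split /=.
rewrite /product_sum eta_sum_first_blocks; apply: eq_bigr => -[z p] _.
rewrite -!big_split /= /prefixed.
rewrite (eq_eta_sum _ (fun w => eta_sum_first_blocks _ _ _)) eta_sum_sum scaler_sumr.
apply: eq_bigr => -[z' q] _ /=.
rewrite eta_sum_scale scalerA -natrM -!scalerDr -!eta_sum_add; congr (_ *: _).
apply: eq_eta_sum => a; rewrite -!eta_sum_add; apply: eq_eta_sum => b.
by rewrite /prefixed quasi_sum_cons.
Qed.

(** The current block ends, or turns to the second word, or absorbs another letter of the first. The
    coefficients of the last two, 2 and 1, are those that the signed sum produces after a rho. *)
Lemma left_sum_rec F x u v :
  left_sum F x u v = 2 *: product_sum (prefixed F x) u v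
    + (if v is b :: v' then 2 *: right_sum F (bullet x b) u v' else 0)
    + (if u is a :: u' then left_sum F (bullet x a) u' v else 0).
Proof. by rewrite /left_sum; case: u => [|a u] /=; rewrite big_cons ?big_nil. Qed.

Lemma right_sum_rec F y u v :
  right_sum F y u v = 2 *: product_sum (prefixed F y) u v
    + (if v is b :: v' then right_sum F (bullet y b) u v' else 0).
Proof. by rewrite /right_sum; case: v => [|b v] /=; rewrite big_cons ?big_nil. Qed.

(** Two empty words are excluded: there the left side is [F [::]] and the right side is 0. *)
Lemma product_sum_rec F u v : (0 < size u + size v)%N ->
  product_sum F u v =
  (if u is a :: u' then left_sum F a u' v else 0)
  + (if v is b :: v' then right_sum F b u v' else 0).
Proof.
case: u v => [|a u] [|b v] // _; last exact: product_sum_cons.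
- rewrite product_sum0l add0r eta_sum_first_blocks; apply: eq_bigr => zp _.
  by rewrite product_sum0l.
- rewrite product_sum0r addr0 eta_sum_first_blocks; apply: eq_bigr => zp _.
  by rewrite product_sum0r addr0.
Qed.

End Sums.

(** * Signed sum over shuffles *)

(** This generalizes [word_shuffle] to arbitrary words [U] and [V], so that letters can be removed
    one at a time. *)
Definition shuffle_of (L : eqType) (rho : pred L) (U V w : seq L) : bool :=
  ([seq a <- w | rho a] == U) && ([seq a <- w | ~~ rho a] == V).

Lemma big_tuple0 (L : finType) (V : zmodType) (P : pred (0.-tuple L)) (F : 0.-tuple L -> V) :
  \sum_(w | P w) F w = if P [tuple] then F [tuple] else 0.
Proof.
rewrite big_mkcond (bigD1 [tuple]) //= [X in _ + X]big1 ?addr0 // => w /eqP ne.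
by case: (ne (tuple0 w)).
Qed.

Lemma big_cons_tuple (L : finType) (V : zmodType) k (P : pred (seq L)) (F : seq L -> V) :
  \sum_(w : k.+1.-tuple L | P w) F w =
  \sum_(a : L) \sum_(w : k.-tuple L | P (a :: w)) F (a :: w).
Proof.
rewrite pair_big_dep /=.
rewrite (reindex (fun p : L * k.-tuple L => cons_tuple p.1 p.2)) //=.
exists (fun w : k.+1.-tuple L => (thead w, [tuple of behead w])) => [[a w] _|w _] /=.
  by congr (_, _); apply: val_inj.
by apply: val_inj; rewrite /= [in RHS](tuple_eta w).
Qed.

(** The value of [rho] on the first letter decides which word it comes from, and it must then be the
    head of that word. *)
Lemma big_shuffle_cons (L : finType) (V : zmodType) (rho : pred L) k (U W : seq L)
    (F : seq L -> V) : all rho U -> all (predC rho) W ->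
  \sum_(w : k.+1.-tuple L | shuffle_of rho U W w) F w =
  (if U is a :: U' then \sum_(w : k.-tuple L | shuffle_of rho U' W w) F (a :: w) else 0)
  + (if W is b :: W' then \sum_(w : k.-tuple L | shuffle_of rho U W' w) F (b :: w) else 0).
Proof.
move=> hU hW; rewrite big_cons_tuple (bigID rho) /=; congr (_ + _).
- case: U hU => [|u U] hU.
    rewrite big1 // => a ha; rewrite big_pred0 // => w.
    by rewrite /shuffle_of /= ha.
  case/andP: hU => hu _.
  rewrite (bigD1 u) //= [X in _ + X]big1 ?addr0 => [|a /andP[ha au]].
    by apply: eq_bigl => w; rewrite /shuffle_of /= hu /= eqseq_cons eqxx.
  rewrite big_pred0 // => w.
  by rewrite /shuffle_of /= ha eqseq_cons (negPf au).
- case: W hW => [|u W] hW.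
    rewrite big1 // => a ha; rewrite big_pred0 // => w.
    by rewrite /shuffle_of /= ha andbF.
  case/andP: hW => /= hu _.
  rewrite (bigD1 u) //= [X in _ + X]big1 ?addr0 => [|a /andP[ha au]].
    apply: eq_bigl => w; rewrite /shuffle_of /= hu (negPf hu) /=.
    by rewrite eqseq_cons eqxx.
  rewrite big_pred0 // => w.
  by rewrite /shuffle_of /= ha eqseq_cons (negPf au) andbF.
Qed.

(* [t], [t'] tell whether two consecutive letters come from the first word. *)
Definition connective_weight (K : fieldType) (t : bool) (c : connective) (t' : bool) : K :=
  if c is Bullet then if t == t' then 0 else if t then 1 else -1 else 1.

Fixpoint expression_weight (K : fieldType) (t : bool) (cs : seq connective) (ts : seq bool) : K :=
  match cs, ts with
  | c :: cs', t' :: ts' => connective_weight K t c t' * expression_weight K t' cs' ts'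
  | _, _ => 1
  end.

Section Shuffles.
Variables (K : fieldType) (V : lmodType K) (L : finType) (rho : pred L) (d : L -> diagram).
Implicit Types (F : seq diagram -> V) (x : diagram) (U W : seq L).

(* The bullets that are not admissible have weight 0, so all connectives are allowed. *)
Definition shuffle_sum F k t x U W : V :=
  \sum_(w : k.-tuple L | shuffle_of rho U W w) \sum_(cs : k.-tuple connective)
    expression_weight K t cs (map rho w) *: coarsening_sum F x (zip cs (map d w)).

Lemma big_connective (G : connective -> V) : \sum_c G c = G Tensor + G Bullet.
Proof.
rewrite (bigD1 Tensor) //= (bigD1 Bullet) //= big1 ?addr0 // => -[] //.
Qed.

(** A tensor before [a] is either kept, closing the block [x] with its factor 2, or coarsened, with
    coefficient 1; an original bullet adds its own weight to the merged case. *)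
Lemma shuffle_sum_step F k t x a U W :
  \sum_(w : k.-tuple L | shuffle_of rho U W w) \sum_(cs : k.+1.-tuple connective)
    expression_weight K t cs (map rho (a :: w)) *: coarsening_sum F x (zip cs (map d (a :: w)))
  = 2 *: shuffle_sum (prefixed F x) k (rho a) (d a) U W
  + (1 + connective_weight K t Bullet (rho a))
      *: shuffle_sum F k (rho a) (bullet x (d a)) U W.
Proof.
rewrite /shuffle_sum !scaler_sumr -big_split; apply: eq_bigr => w _ /=.
pose G cs : V := expression_weight K t cs (rho a :: map rho w) *:
  coarsening_sum F x (zip cs (d a :: map d w)).
rewrite (big_cons_tuple _ (fun=> true) G) big_connective !scaler_sumr -!big_split.
apply: eq_bigr => cs _; rewrite /G /= !coarsening_sum_cons add0r mul1r.
by rewrite !scalerDr scalerDl !scalerA mul1r addrA mulrC.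
Qed.

(** Both sides satisfy the same recursion on the number of remaining letters; [t] records the word
    of the last letter of the open block [x]. *)
Lemma shuffle_sumE F k t x U W : all rho U -> all (predC rho) W ->
  (size U + size W)%N = k ->
  shuffle_sum F k t x U W =
  if t then left_sum F x (map d U) (map d W) else right_sum F x (map d U) (map d W).
Proof.
elim: k F t x U W => [|k IH] F t x U W hU hW.
  case: U W hU hW => [|//] [|//] _ _ _ /=.
  rewrite left_sum_rec right_sum_rec product_sum0l !addr0 if_same.
  by rewrite /shuffle_sum !big_tuple0 /= scale1r coarsening_sum_nil.
move=> sz; rewrite /shuffle_sum.
pose H w : V := \sum_(cs : k.+1.-tuple connective)
  expression_weight K t cs (map rho w) *: coarsening_sum F x (zip cs (map d w)).
rewrite (big_shuffle_cons _ H hU hW) {}/H.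
have sz' : (0 < size (map d U) + size (map d W))%N by rewrite !size_map sz.
rewrite left_sum_rec right_sum_rec !product_sum_rec // {sz'}.
case: U hU sz => [|u U] hU sz; case: W hW sz => [|b W] hW sz; rewrite // ?shuffle_sum_step;
  try case/andP: (hU) => hu hU'; try case/andP: (hW) => /= hb hW'.
all: move: sz; rewrite /= ?addnS ?addSn => -[sz].
- rewrite (negPf hb) !IH //=; case: t => /=; last by rewrite addr0 scale1r !add0r.
  by rewrite !add0r addr0.
- rewrite addn0 in sz; rewrite hu !IH ?addn0 //=; case: t => /=;
    last by rewrite subrr scale0r !addr0.
  by rewrite !addr0 scale1r.
rewrite hu (negPf hb) !IH //= ?addnS //; case: t => /=.
  (* After a rho, merging a sigma has coefficient 1 + 1 and merging a rho has 1 + 0. *)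
  by rewrite addr0 scale1r scalerDr -[1 + 1]/2 addrAC !addrA.
(* After a sigma, merging a rho has coefficient 1 - 1 and merging a sigma has 1 + 0. *)
by rewrite subrr scale0r !addr0 scale1r scalerDr !addrA.
Qed.

End Shuffles.

(** * The product of ParQSym *)

(** [star] is defined through supports and coefficients. This evaluates such a sum on any
    presentation as a linear combination, even with repeated basis elements. *)
Lemma malg_sum_scale (K : fieldType) (D : choiceType) (V : lmodType K) (g : D -> V)
    (I : eqType) (r : seq I) (a : I -> K) (p : I -> D) :
  let x : {malg K[D]} := \sum_(i <- r) a i *: << p i >> in
  \sum_(d <- msupp x) x@_d *: g d = \sum_(i <- r) a i *: g (p i).
Proof.
move=> x.
have xE d : x@_d = \sum_(i <- r) a i *+ (p i == d).
  rewrite /x raddf_sum; apply: eq_bigr => i _.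
  by rewrite /= mcoeffZ mcoeffU mulrnAr mulr1.
(* [S] may exceed the support because of cancellations; the coefficients there are 0. *)
pose S : {fset D} := [fset d in [seq p i | i <- r]]%fset.
have sub : (msupp x `<=` S)%fset.
  apply/fsubsetP => d; rewrite -mcoeff_neq0 xE !inE; apply: contraNT => nd.
  rewrite big_seq big1 // => i ir; case: eqP => // e.
  by case/negP: nd; apply/mapP; exists i.
rewrite (big_fset_incl _ sub) /=; last first.
  by move=> d _ nd; rewrite mcoeff_outdom // scale0r.
under eq_bigr do rewrite xE scaler_suml.
rewrite exchange_big big_seq [RHS]big_seq; apply: eq_bigr => i ir /=.
have iS : p i \in S by rewrite !inE; apply: map_f.
rewrite (big_fsetD1 _ iS) /= eqxx big_seq big1 ?addr0 // => d.
by rewrite !inE eq_sym => /andP[/negPf -> _]; rewrite scale0r.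
Qed.

Lemma star_sum (K : fieldType) (I J : eqType) (r : seq I) (s : seq J)
    (a : I -> K) (b : J -> K) (p : I -> diagram) (q : J -> diagram) :
  star (\sum_(i <- r) a i *: basisM K (p i)) (\sum_(j <- s) b j *: basisM K (q j)) =
  \sum_(i <- r) a i *: \sum_(j <- s) b j *: star_basis K (p i) (q j).
Proof.
rewrite /star -(malg_sum_scale (fun c => \sum_(j <- s) b j *: star_basis K c (q j))).
cbv zeta; apply: eq_bigr => c _.
rewrite -[in RHS](malg_sum_scale (star_basis K c)) scaler_sumr.
by apply: eq_bigr => d _; rewrite scalerA.
Qed.

Definition shuffled_pairs (u v : seq diagram) (w : seq (diagram * diagram)) : bool :=
  [&& [seq p <- unzip1 w | p != empty_diagram] == u,
      [seq p <- unzip2 w | p != empty_diagram] == v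
    & all (fun pq => bullet pq.1 pq.2 != empty_diagram) w].

Lemma order_neq0 p : (p != empty_diagram) = (0 < order p)%N.
Proof. by apply/idP/idP => [/eqP/order_gt0|/order_gt0/eqP]. Qed.

Lemma mem_map_cons (T : eqType) (x y : T) (w : seq T) (ws : seq (seq T)) :
  (y :: w \in [seq x :: w | w <- ws]) = (y == x) && (w \in ws).
Proof.
apply/mapP/andP => [[w' h [-> ->]]|[/eqP -> h]]; first by rewrite eqxx.
by exists w.
Qed.

(** A uniform unfolding, also valid when one word is empty, where the definition gives its single
    result at once. *)
Lemma quasi_shuffleE u v : (0 < size u + size v)%N ->
  quasi_shuffle u v =
  (if u is a :: u' then [seq (a, empty_diagram) :: w | w <- quasi_shuffle u' v] else [::])
  ++ (if v is b :: v' then [seq (empty_diagram, b) :: w | w <- quasi_shuffle u v'] else [::])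
  ++ (if (u, v) is (a :: u', b :: v') then [seq (a, b) :: w | w <- quasi_shuffle u' v']
      else [::]).
Proof. by case: u v => [|a [|a' u]] [|b v] //=; rewrite ?cats0. Qed.

(** By induction on [w]: its first pair has an empty right entry, an empty left entry, or neither,
    which matches the three branches because all letters are non-empty. *)
Lemma mem_quasi_shuffle u v w : all_nonempty u -> all_nonempty v ->
  (w \in quasi_shuffle u v) = shuffled_pairs u v w.
Proof.
elim: w u v => [|[p q] w IH] u v hu hv.
  case: (posnP (size u + size v)%N) => [|h]; first by case: u v {hu hv} => [|a u] [|b v].
  rewrite quasi_shuffleE // !mem_cat.
  case: u v h {hu hv} => [|a u] [|b v] //= _; rewrite ?in_nil //=;
    by do ?[case: mapP => [[? _ //]|_]].
case: (posnP (size u + size v)%N) => [|h].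
  case: u v {hu hv} => [|a u] [|b v] // _; rewrite inE /shuffled_pairs /=.
  by have [->|p0] := eqVneq p empty_diagram; have [->|q0] := eqVneq q empty_diagram;
    rewrite ?andbF.
rewrite quasi_shuffleE // !mem_cat /shuffled_pairs /= (order_neq0 (bullet p q)).
rewrite (order_join Bullet) addn_gt0 -!order_neq0.
have neq c : (0 < order c)%N -> (empty_diagram == c) = false.
  by rewrite eq_sym -order_neq0 => /negbTE.
(* Abstracting the function keeps it from being unfolded by simplification in the case analysis. *)
move: quasi_shuffle IH => Q IH.
case: u v hu hv h => [|a u] [|b v] //=
  => [_ /andP[b0 hv] _|/andP[a0 hu] _ _|/andP[a0 hu] /andP[b0 hv] _];
  rewrite ?in_nil ?orbF !mem_map_cons !xpair_eqE !IH //= ?b0 ?a0 ?hu ?hv //= /shuffled_pairs;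
  have [->|p0] := eqVneq p empty_diagram; have [->|q0] := eqVneq q empty_diagram;
    rewrite /= ?neq ?eqseq_cons ?andbF ?orbF //= ?(negPf p0) ?(negPf q0) ?andbF ?andbT //= -?andbA;
    do ?bool_congr.
Qed.

(** The three branches start with different pairs because the letters are non-empty. *)
Lemma quasi_shuffle_uniq u v : all_nonempty u -> all_nonempty v ->
  uniq (quasi_shuffle u v).
Proof.
have [n] := ubnP (size u + size v)%N.
elim: n u v => // n IH u v /ltnSE le hu hv.
have [|h] := posnP (size u + size v)%N; first by case: u v {hu hv le} => [|a u] [|b v].
rewrite quasi_shuffleE //.
have neq c : (0 < order c)%N -> (c == empty_diagram) = false.
  by rewrite -order_neq0 => /negbTE.
have U a u' v' : (size u' + size v' < n)%N -> all_nonempty u' -> all_nonempty v' ->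
    uniq [seq a :: w | w <- quasi_shuffle u' v'].
  by move=> *; rewrite map_inj_uniq ?IH // => ? ? [].
have disj a b (ws1 ws2 : seq (seq (diagram * diagram))) : a != b ->
    ~~ has (mem [seq a :: w | w <- ws1]) [seq b :: w | w <- ws2].
  move=> ab; apply/hasPn => _ /mapP[w _ ->] /=.
  by rewrite mem_map_cons eq_sym (negPf ab).
have NE c w : all_nonempty (c :: w) = (0 < order c)%N && all_nonempty w by [].
case: u v hu hv le h => [|a u] [|b v] //; rewrite ?NE.
- by move=> /andP[a0 hu] hv le _; rewrite !cats0; apply: U.
move=> /andP[a0 hu] /andP[b0 hv] le _.
have le' : (size u + size v < n)%N.
  by apply: leq_trans le; rewrite /= addnS addSn.
rewrite !cat_uniq has_cat negb_or !disj ?xpair_eqE ?(eq_sym empty_diagram) ?neq ?andbF //.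
by rewrite !U // ?NE ?b0 ?a0 //; move: le; rewrite /= ?addSn ?addnS.
Qed.

Lemma star_basis_tensors (K : fieldType) u v :
  (0 < size u)%N -> (0 < size v)%N ->
  letters (pred1 Tensor) u -> letters (pred1 Tensor) v ->
  star_basis K (tensors u) (tensors v) = quasi_sum (fun w => basisM K (tensors w)) u v.
Proof.
move=> u0 v0 hu hv.
have T0 w : (0 < size w)%N -> letters (pred1 Tensor) w -> (tensors w == empty_diagram) = false.
  case: w => [//|a w] _ /letters_cons[[a0 _] _]; apply/negbTE.
  by rewrite order_neq0 order_tensor ltn_addr.
rewrite /star_basis !T0 // !tensor_factorsK // /quasi_sum.
have [nu nv] := (letters_nonempty hu, letters_nonempty hv).
have -> : quasi_shuffles u v = [set` quasi_shuffle u v]%classic.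
  apply/seteqP; split=> w /=; rewrite mem_quasi_shuffle // /shuffled_pairs.
    by case=> -> -> ->; rewrite !eqxx.
  by case/and3P => /eqP ? /eqP ? ?; split.
by rewrite -fsbig_seq ?quasi_shuffle_uniq.
Qed.

Lemma coarsenings_size x l w : w \in coarsenings x l -> (0 < size w)%N.
Proof.
elim: l x => [|[c a] l IH] x /=; first by rewrite inE => /eqP ->.
by rewrite mem_cat => /orP[|/IH //]; case: c => // /mapP[v _ ->].
Qed.

Lemma unzip2_tensor_word u : unzip2 (tensor_word u) = u.
Proof. by rewrite /unzip2 -map_comp map_id. Qed.

Lemma eta_tensors (K : fieldType) x u : letters (pred1 Tensor) (x :: u) ->
  eta K (tensors (x :: u)) =
  \sum_(w <- coarsenings x (tensor_word u)) (2 ^+ size w : K) *: basisM K (tensors w).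
Proof. by move=> h; rewrite tensorsE // eta_evaluate // unzip2_tensor_word. Qed.

Lemma star_eta (K : fieldType) x u y v :
  letters (pred1 Tensor) (x :: u) -> letters (pred1 Tensor) (y :: v) ->
  star (eta K (tensors (x :: u))) (eta K (tensors (y :: v))) =
  product_sum (fun w => basisM K (tensors w)) (x :: u) (y :: v).
Proof.
move=> hu hv; rewrite !eta_tensors // star_sum /product_sum.
rewrite [LHS]big_seq [RHS]big_seq; apply: eq_bigr => p hp; congr (_ *: _).
rewrite [LHS]big_seq [RHS]big_seq; apply: eq_bigr => q hq; congr (_ *: _).
apply: star_basis_tensors; rewrite ?(coarsenings_size hp) ?(coarsenings_size hq) //.
- by apply: coarsenings_letters hp; rewrite unzip2_tensor_word.
- by apply: coarsenings_letters hq; rewrite unzip2_tensor_word.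
Qed.

(** * Admissible expressions *)

Lemma expression_weight_prod (K : fieldType) N t (cs : N.-tuple connective) (ts : seq bool) :
  size ts = N ->
  expression_weight K t cs ts =
  \prod_(l < N) connective_weight K (nth false (t :: ts) l) (tnth cs l)
                                    (nth false (t :: ts) l.+1).
Proof.
elim: N t cs ts => [|N IH] t cs ts; first by rewrite tuple0 big_ord0.
case: ts => [//|t' ts] [sz]; rewrite (tuple_eta cs) big_ord_recl /=.
rewrite tnth0 (IH t' (behead_tuple cs)) //; congr (_ * _).
by apply: eq_bigr => l _; rewrite !tnthS.
Qed.

(** A bullet between letters of the same word contributes a factor 0; otherwise each bullet from
    sigma to rho contributes -1 and every other connective 1. *)
Lemma expression_weightE (K : fieldType) N t (cs : N.-tuple connective) (ts : seq bool) :
  size ts = N ->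
  expression_weight K t cs ts =
  if [forall l : 'I_N, (tnth cs l == Bullet)
        ==> (nth false (t :: ts) l != nth false (t :: ts) l.+1)]
  then (-1) ^+ #|[pred l : 'I_N | [&& tnth cs l == Bullet,
          ~~ nth false (t :: ts) l & nth false (t :: ts) l.+1]]|
  else 0.
Proof.
move=> sz; rewrite expression_weight_prod //.
case: ifP => [/forallP adm|/negbT].
  rewrite -prodr_const [RHS]big_mkcond; apply: eq_bigr => l _.
  have := adm l; rewrite inE /connective_weight.
  by move: (tnth cs l) (nth _ _ l) (nth _ _ l.+1) => [] [] [].
rewrite negb_forall => /existsP[l]; rewrite negb_imply negbK => /andP[/eqP b /eqP e].
by rewrite (bigD1 l) //= b /connective_weight e eqxx mul0r.
Qed.

(** Inadmissible connectives are added with weight 0. Once the first letter is split off, each part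
    is a [shuffle_sum] whose open block is that letter. *)
Lemma big_admissible (K : fieldType) (V : lmodType K) n m (r : n.+1.-tuple diagram)
    (s : m.-tuple diagram) (F : seq diagram -> V) :
  \sum_(e : expression n.+1 m | admissible e) (-1) ^+ sign_exponent e
     *: coarsening_sum F (letter_diagram r s (thead e.1))
          (zip e.2 (map (letter_diagram r s) (behead e.1)))
  = product_sum F r s.
Proof.
set d := letter_diagram r s.
pose U : seq (letter n.+1 m) := [seq inl i | i <- enum 'I_n.+1].
pose W : seq (letter n.+1 m) := [seq inr i | i <- enum 'I_m].
pose H (w : seq (letter n.+1 m)) : V := if w is a :: w' then
  \sum_(cs : (n + m).-tuple connective)
    expression_weight K (is_rho a) cs (map (@is_rho n.+1 m) w')
      *: coarsening_sum F (d a) (zip cs (map d w')) else 0.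
(* With [n.+1] letters in the first word, the total is [(n + m).+1] and the number of connectives
   [n + m], both by conversion. *)
transitivity (\sum_(w : (n + m).+1.-tuple (letter n.+1 m) | shuffle_of (@is_rho n.+1 m) U W w) H w).
  rewrite big_mkcond [RHS]big_mkcond /=.
  rewrite -(pair_bigA _ (fun w cs => if admissible ((w, cs) : expression n.+1 m) then
    (-1) ^+ sign_exponent ((w, cs) : expression n.+1 m)
      *: coarsening_sum F (d (thead w)) (zip cs (map d (behead w))) else 0)) /=.
  apply: eq_bigr => w _; rewrite /admissible /=.
  rewrite -[word_shuffle w]/(shuffle_of (@is_rho n.+1 m) U W w).
  case: shuffle_of => /=; last by rewrite big1.
  rewrite (tuple_eta w) /=; apply: eq_bigr => cs _.
  rewrite expression_weightE; last by rewrite size_map size_tuple.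
  rewrite /sign_exponent /rho_at /=.
  by case: ifP => //; rewrite scale0r.
have dU : map d U = r by rewrite -map_comp map_tnth_enum.
have dW : map d W = s by rewrite -map_comp map_tnth_enum.
have hU : all (@is_rho n.+1 m) U by rewrite all_map; apply/allP.
have hW : all (predC (@is_rho n.+1 m)) W by rewrite all_map; apply/allP.
rewrite (big_shuffle_cons _ H hU hW) -dU -dW {}/H.
have sU : size U = n.+1 by rewrite size_map size_enum_ord.
have sW : size W = m by rewrite size_map size_enum_ord.
clearbody U W; case: U hU sU {dU dW} => [//|u U] /andP[hu hU] [sU].
rewrite product_sum_rec //; congr (_ + _).
  by rewrite -/(shuffle_sum (@is_rho n.+1 m) d F _ _ _ _ _) hu shuffle_sumE // sU sW.
case: W hW sW => [//|b W] /andP[/negPf hb hW] sW.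
rewrite -/(shuffle_sum (@is_rho n.+1 m) d F _ _ _ _ _) hb shuffle_sumE //=.
  by rewrite hu.
by have /= e := sW; rewrite sU addSn -addnS e.
Qed.

Theorem proposition8p2 (K : fieldType) (two_unit : (2 : K) \is a GRing.unit)
    (n m : nat) (rho sigma : diagram)
    (r : n.-tuple diagram) (s : m.-tuple diagram)
    (rho_nonempty : rho <> empty_diagram)
    (sigma_nonempty : sigma <> empty_diagram)
    (r_irreducible : forall i : 'I_n,
       tnth r i <> empty_diagram /\ tensor_irreducible (tnth r i))
    (s_irreducible : forall j : 'I_m,
       tnth s j <> empty_diagram /\ tensor_irreducible (tnth s j))
    (rhoE : rho = tensors r) (sigmaE : sigma = tensors s) :
  star (eta K rho) (eta K sigma) =
  \sum_(e : expression n m | admissible e)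
    (-1) ^+ sign_exponent e *: eta K (value r s e).
Proof.
have letters_tuple k (t : k.-tuple diagram) :
    (forall i, tnth t i <> empty_diagram /\ tensor_irreducible (tnth t i)) ->
    letters (pred1 Tensor) t.
  by move=> h _ /tnthP[i ->]; apply/irreducible_tensor.
have hr := letters_tuple _ _ r_irreducible.
have hs := letters_tuple _ _ s_irreducible.
case: n r r_irreducible rhoE hr => [|n] r r_irreducible rhoE hr.
  by case: rho_nonempty; rewrite rhoE tuple0.
case: m s s_irreducible sigmaE hs => [|m] s s_irreducible sigmaE hs.
  by case: sigma_nonempty; rewrite sigmaE tuple0.
have hd a : irreducible (pred1 Tensor) (letter_diagram r s a).
  by case: a => i; apply/irreducible_tensor; [apply: r_irreducible|apply: s_irreducible].
transitivity (product_sum (fun w => basisM K (tensors w)) r s).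
  move: hr hs; rewrite rhoE sigmaE (tuple_eta r) (tuple_eta s) => hr hs.
  exact: star_eta.
rewrite -big_admissible; apply: eq_bigr => e _; congr (_ *: _).
(* With its first letter exposed, the value of [e] is an [evaluate] by conversion; the resulting sum
   is the [coarsening_sum] of the left side. *)
rewrite /value (tuple_eta e.1) /= [RHS]eta_evaluate //.
rewrite -cat1s => a; rewrite mem_cat => /orP[|].
  by rewrite inE => /eqP ->.
rewrite unzip2_zip; last by rewrite size_map !size_tuple.
by case/mapP => b _ ->.
Qed.
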